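(* For $t\in\mathbb{N}$ with $t\ge2$, the underlying treewidth of the class of $K_t$-topological-minor-free graphs equals $t-2$ if $t\in\{2,3,4\}$ and equals $t$ if $t\ge5$.
   Context: Graphs are finite, simple and undirected; $\mathrm{tw}$ denotes treewidth. A graph is $K_t$-topological-minor-free if it has no subgraph isomorphic to a subdivision of $K_t$. For graphs $G,H$, an $H$-partition of $G$ is a partition $(V_x : x\in V(H))$ of $V(G)$ such that for every edge $vw$ of $G$ with $v\in V_x$, $w\in V_y$, either $x=y$ or $xy\in E(H)$; its width is $\max_x|V_x|$. $\mathrm{tpw}_c(G)$ is the minimum width of an $H$-partition of $G$ over all graphs $H$ with $\mathrm{tw}(H)\le c$. The underlying treewidth of a graph class $\mathcal{G}$ is the minimum $c\in\mathbb{N}_0$ for which there is a function $f$ with $\mathrm{tpw}_c(G)\le f(\mathrm{tw}(G))$ for all $G\in\mathcal{G}$ (unbounded if no such $c$ exists). *)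

(* Defs.v *)
From mathcomp Require Import all_boot.
Set Implicit Arguments. Unset Strict Implicit. Unset Printing Implicit Defensive.

Definition simple_graph (T : finType) (e : rel T) : Prop :=
  symmetric e /\ irreflexive e.

Definition is_tree (I : finType) (E : rel I) : Prop :=
  [/\ simple_graph E, 0 < #|I|,
      (forall x y : I, connect E x y) &
      (forall c : seq I, ucycle E c -> size c <= 2)].

Definition tree_decomposition_width_le (T : finType) (e : rel T)
    (I : finType) (E : rel I) (B : I -> {set T}) (k : nat) : Prop :=
  [/\ is_tree E,
      (forall v : T, exists i : I, v \in B i),
      (forall v w : T, e v w -> exists i : I, (v \in B i) && (w \in B i)),
      (forall (v : T) (i j : I), v \in B i -> v \in B j ->
          connect [rel a b | [&& E a b, v \in B a & v \in B b]] i j) &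
      (forall i : I, #|B i| <= k.+1)].

Definition tw_le (T : finType) (e : rel T) (k : nat) : Prop :=
  exists (I : finType) (E : rel I) (B : I -> {set T}),
    tree_decomposition_width_le e E B k.

Definition is_tw (T : finType) (e : rel T) (k : nat) : Prop :=
  tw_le e k /\ forall k', tw_le e k' -> k <= k'.

Definition has_Kt_subdivision (t : nat) (T : finType) (e : rel T) : Prop :=
  exists (b : 'I_t -> T) (P : 'I_t -> 'I_t -> seq T),
    [/\ injective b,
        (forall i j : 'I_t, i < j ->
            path e (b i) (rcons (P i j) (b j)) &&
            uniq (b i :: rcons (P i j) (b j))),
        (forall (i j : 'I_t) (v : T), i < j -> v \in P i j ->
            forall l : 'I_t, v != b l) &
        (forall (i j i' j' : 'I_t) (v : T), i < j -> i' < j' ->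
            (i, j) != (i', j') -> v \in P i j -> v \notin P i' j')].

Definition Kt_topminor_free (t : nat) (T : finType) (e : rel T) : Prop :=
  ~ has_Kt_subdivision t e.

Definition is_H_partition (T : finType) (e : rel T)
    (U : finType) (eH : rel U) (part : T -> U) : Prop :=
  forall v w : T, e v w -> part v = part w \/ eH (part v) (part w).

Definition partition_width_le (T U : finType) (part : T -> U) (k : nat) :=
  forall x : U, #|[set v | part v == x]| <= k.

Definition tpw_le (c : nat) (T : finType) (e : rel T) (k : nat) : Prop :=
  exists (U : finType) (eH : rel U) (part : T -> U),
    [/\ simple_graph eH, tw_le eH c, is_H_partition e eH part &
        partition_width_le part k].

Definition graph_class := forall T : finType, rel T -> Prop.

Definition tpw_bounded_by_tw (C : graph_class) (c : nat) : Prop :=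
  exists f : nat -> nat, forall (T : finType) (e : rel T),
    simple_graph e -> C T e -> forall k, is_tw e k -> tpw_le c e (f k).

Definition underlying_tw (C : graph_class) (c : nat) : Prop :=
  tpw_bounded_by_tw C c /\ forall c', tpw_bounded_by_tw C c' -> c <= c'.

(* Main.v *)
Require Import Defs.
From mathcomp Require Import all_boot zify.
Set Implicit Arguments. Unset Strict Implicit. Unset Printing Implicit Defensive.

(* A tree decomposition of width [k] is handled as an elimination order: a strict
   forest order [lt] on the vertices in which adjacent vertices are comparable
   and at most [k] vertices below [v] have a neighbour in the up-set of [v].

   Upper bound.  Call [e] disjointed when no connected set [X] contains [n]
   disjoint connected subsets that are all adjacent to the same [c] vertices
   outside [X].  A graph with no subdivision of K_t is disjointed for c = t: give
   each pair of the t vertices a subset of its own.  For t <= 4 it is disjointed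
   for c = t - 2, because the linking paths inside the connected set [X] provide
   the two remaining branch vertices.  A disjointed graph of treewidth [k] is
   partitioned greedily.  Let [X] be a component of the remaining vertices, seeing
   the parts S_1, ..., S_c.  By the Erdős–Pósa property of connected sets, boundedly
   many bags meet every connected subset of [X] adjacent to all the S_i. Closing
   that set of bags under meets in the forest order, the part of [X] they cover is
   taken as a new part [Q].  Every component of [X] minus [Q] misses some S_i, and
   meet-closure ensures that it sees at most 2(k + 1) vertices of [Q], so that the
   sizes do not grow along the recursion.

   Lower bound.  Join [r] vertices, one on each level of an [N]-ary tree, to many
   disjoint long paths below each branch, in such a way that path vertices have
   degree at most 3.  If this graph had an H-partition of small width with
   tw(H) < r + 1, then for some branch the [r] nodes would lie in distinct parts,
   below all the parts met by some path; every segment of the path long enough to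
   see all [r] nodes would then be forced into the same part, which is too small.
   The largest branch vertex of a subdivision of K_t has t - 1 vertices in its
   elimination set and t - 1 neighbours, which excludes K_t for r = t - 3, and also
   for r = t - 1 when t >= 5. *)

(** * Connected sets *)

Lemma connect_exit (T : finType) (r : rel T) (S : {pred T}) x y :
  connect r x y -> x \in S -> y \notin S ->
  exists a b, [/\ a \in S, b \notin S & r a b].
Proof.
move=> /connectP[p]; elim: p x => [|z p IH] x /=; first by move=> _ -> ->.
case/andP=> rxz zp yE xS yS; case: (boolP (z \in S)) => [zS|zS].
  exact: IH zp yE zS yS.
by exists x, z.
Qed.

Lemma card_bigcup_leq (I U : finType) (f : I -> {set U}) (Z : {set I}) b :
  (forall z, #|f z| <= b) -> #|\bigcup_(z in Z) f z| <= #|Z| * b.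
Proof.
move=> fb; apply: leq_trans (_ : \sum_(z in Z) #|f z| <= _); last first.
  by rewrite -sum_nat_const; apply: leq_sum.
elim/big_rec2: _ => [|z n S _ IH]; first by rewrite cards0.
by apply: leq_trans (leq_card_setU _ _) _; rewrite leq_add2l.
Qed.

Section Connected.
Variables (T : finType) (e : rel T).
Hypothesis e_sym : symmetric e.

Definition restr (X : {set T}) : rel T := [rel a b | [&& a \in X, b \in X & e a b]].

(** The empty set counts as connected, so nonemptiness is a separate hypothesis wherever a root is
    needed. *)
Definition conn (X : {set T}) : bool :=
  [forall a in X, [forall b in X, connect (restr X) a b]].

Definition adj (X : {set T}) (v : T) : bool := [exists u in X, e u v].

Definition bdry (X : {set T}) : {set T} := [set v | (v \notin X) && adj X v].

Definition comp (X : {set T}) (x : T) : {set T} := [set y | connect (restr X) x y].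

Lemma connP (X : {set T}) : reflect {in X &, forall a b, connect (restr X) a b} (conn X).
Proof.
apply: (iffP idP) => [/forall_inP cX a b aX bX|cX].
  by move/forall_inP: (cX a aX); apply.
by apply/forall_inP => a aX; apply/forall_inP => b bX; apply: cX.
Qed.

Lemma restr_sym X : symmetric (restr X).
Proof. by move=> a b; rewrite /restr /= e_sym andbCA. Qed.

Lemma conn_exit (X : {set T}) (S : {pred T}) x y : conn X -> x \in X -> y \in X -> x \in S -> y \notin S ->
  exists a b, [/\ a \in X, b \in X, a \in S, b \notin S & e a b].
Proof.
move=> /connP cX xX yX xS yS.
have [a [b [aS bS /and3P[aX bX eab]]]] := connect_exit (cX _ _ xX yX) xS yS.
by exists a, b.
Qed.

Lemma comp_self X x : x \in comp X x.
Proof. by rewrite inE connect0. Qed.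

Lemma comp_sub (X : {set T}) x : x \in X -> comp X x \subset X.
Proof.
move=> xX; apply/subsetP => y; rewrite inE => cxy.
apply/negPn/negP => yX.
by have [a [b [_ /negP bX /and3P[_ bX' _]]]] := connect_exit cxy xX yX.
Qed.

Lemma comp_closed (X : {set T}) x a b : x \in X -> a \in comp X x -> b \in X -> e a b -> b \in comp X x.
Proof.
move=> xX ax bX eab; have aX := subsetP (comp_sub xX) _ ax.
move: ax; rewrite !inE => cxa; apply: connect_trans cxa (connect1 _).
by rewrite /restr /= aX bX.
Qed.

Lemma comp_conn (X : {set T}) x : x \in X -> conn (comp X x).
Proof.
move=> xX.
(* Otherwise a walk in [X] from [x] to [a] leaves the set of vertices reachable inside the
   component, along an edge that itself lies inside the component. *)
have xc a : a \in comp X x -> connect (restr (comp X x)) x a.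
  move=> aC; apply/negPn/negP => nxa.
  have cxa : connect (restr X) x a by move: aC; rewrite inE.
  have [|u [v [uC vC /and3P[uX vX euv]]]] :=
    connect_exit (S := [pred z | connect (restr (comp X x)) x z]) cxa _ nxa.
    by rewrite inE connect0.
  move: uC vC; rewrite !inE => uC /negP[]; apply: (connect_trans uC (connect1 _)).
  have uc : u \in comp X x.
    apply/negPn/negP => nuc.
    by have [p [q [_ /negP nq /and3P[_ /nq]]]] := connect_exit uC (comp_self X x) nuc.
  by rewrite /restr /= uc euv (comp_closed xX uc vX euv).
apply/connP => a b aC bC; apply: (connect_trans (y := x)); last exact: xc.
by rewrite (sym_connect_sym (@restr_sym (comp X x))); exact: xc.
Qed.

Lemma conn_sub_comp (X Y : {set T}) x : conn Y -> Y \subset X -> x \in Y -> Y \subset comp X x.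
Proof.
move=> cY sYX xY; apply/subsetP => y yY; rewrite inE.
have: connect (restr Y) x y by move/connP: cY; apply.
apply: connect_sub => a b /and3P[aY bY eab]; apply: connect1.
by rewrite /restr /= eab !(subsetP sYX).
Qed.

Lemma comp_eq X x y : y \in comp X x -> comp X y = comp X x.
Proof.
rewrite inE => cxy; apply/setP => z; rewrite !inE.
by rewrite (same_connect (sym_connect_sym (@restr_sym X)) cxy).
Qed.

Lemma bdryP (X : {set T}) v : reflect (v \notin X /\ exists2 u, u \in X & e u v) (v \in bdry X).
Proof.
rewrite inE; apply: (iffP andP) => [[vX /exists_inP]|[vX ?]]; first by [].
by split=> //; apply/exists_inP.
Qed.

Lemma conn_path (X : {set T}) x y : conn X -> x \in X -> y \in X ->
  exists p, [/\ path e x p, last x p = y, uniq (x :: p) & {subset p <= X}].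
Proof.
move=> cX xX yX; have /connectP[q] := connP _ cX x y xX yX.
case/shortenP => p pp up _ ->; exists p; split=> //.
  by apply: sub_path pp => a b /and3P[].
by elim: p x xX pp {up} => //= a p IH x xX /andP[/and3P[_ aX _] pp] b;
  rewrite inE => /orP[/eqP->//|]; apply: IH pp _.
Qed.

End Connected.

(** * Elimination orders *)

Section ForestOrder.
Variables (T : finType) (e lt : rel T).

Definition forest_order : Prop :=
  [/\ irreflexive lt, transitive lt &
    forall a b c, lt a c -> lt b c -> [|| a == b, lt a b | lt b a]].

Definition upset (v : T) : {set T} := [set w | (v == w) || lt v w].

Definition elim_set (v : T) : {set T} :=
  [set u | lt u v && [exists w in upset v, e u w]].

Definition elim_bag (v : T) : {set T} := v |: elim_set v.

Definition elim_order (k : nat) : Prop :=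
  [/\ forest_order, (forall u v, e u v -> lt u v || lt v u) &
    forall v, #|elim_set v| <= k].

Definition rank (v : T) := #|[set u | lt u v]|.

End ForestOrder.

Section ElimTheory.
Variables (T : finType) (e lt : rel T).
Hypothesis e_sym : symmetric e.
Hypothesis lt_forest : forest_order lt.
Hypothesis e_lt : forall u v, e u v -> lt u v || lt v u.

Local Notation up := (upset lt).
Local Notation A := (elim_set e lt).
Local Notation B := (elim_bag e lt).

Lemma lt_irr : irreflexive lt. Proof. by case: lt_forest. Qed.
Lemma lt_tr : transitive lt. Proof. by case: lt_forest. Qed.
Lemma lt_chain a b c : lt a c -> lt b c -> [|| a == b, lt a b | lt b a].
Proof. by case: lt_forest => _ _; apply. Qed.

Lemma in_up v w : (w \in up v) = (v == w) || lt v w.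
Proof. by rewrite inE. Qed.

Lemma up_refl v : v \in up v. Proof. by rewrite in_up eqxx. Qed.

Lemma up_trans b a c : b \in up a -> c \in up b -> c \in up a.
Proof.
rewrite !in_up => /orP[/eqP<-//|ab] /orP[/eqP<-|bc]; first by rewrite ab orbT.
by rewrite (lt_tr ab bc) orbT.
Qed.

Lemma up_anti a b : b \in up a -> a \in up b -> a = b.
Proof.
rewrite !in_up => /orP[/eqP//|ab] /orP[/eqP//|ba].
by have := lt_tr ab ba; rewrite lt_irr.
Qed.

Lemma up_chain a b c : c \in up a -> c \in up b -> (b \in up a) || (a \in up b).
Proof.
rewrite !in_up => /orP[/eqP->|ac] /orP[/eqP->|bc]; rewrite ?eqxx ?ac ?bc ?orbT //.
by case/or3P: (lt_chain ac bc) => ->; rewrite ?orbT.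
Qed.

Lemma lt_up a b : lt a b -> b \in up a. Proof. by rewrite in_up orbC => ->. Qed.

Lemma lt_up_lt a b c : lt a b -> c \in up b -> lt a c.
Proof. by move=> ab; rewrite in_up => /orP[/eqP<-//|]; apply: lt_tr. Qed.

Lemma up_neq_lt a b : b \in up a -> a != b -> lt a b.
Proof. by rewrite in_up => /orP[/eqP->|//]; rewrite eqxx. Qed.

Lemma lt_nup a b : lt a b -> a \notin up b.
Proof.
move=> ab; apply/negP => ba; have E := up_anti (lt_up ab) ba.
by move: ab; rewrite E lt_irr.
Qed.

Lemma ltn_rank a b : lt a b -> rank lt a < rank lt b.
Proof.
move=> ab; apply: proper_card; apply/properP; split.
  by apply/subsetP => u; rewrite !inE => /lt_tr; apply.
by exists a; rewrite inE ?ab ?lt_irr.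
Qed.

Lemma elim_setP u v : reflect (lt u v /\ exists2 w, w \in up v & e u w) (u \in A v).
Proof.
rewrite inE; apply: (iffP andP) => [[uv /exists_inP]|[uv ?]]; first by [].
by split=> //; apply/exists_inP.
Qed.

Lemma elim_set_lt u v : u \in A v -> lt u v. Proof. by case/elim_setP. Qed.

(** This is the connectivity axiom of tree decompositions: a vertex in the bag of [z] is in every
    bag met on the way down from [z] to it. *)
Lemma elim_set_down u m z : u \in A z -> lt u m -> z \in up m -> u \in A m.
Proof.
case/elim_setP => uz [w wz euw] um mz; apply/elim_setP; split=> //.
by exists w => //; apply: up_trans wz.
Qed.

(** [elim_set z] separates the up-set of [z] from the rest: a neighbour [b] of [a] outside the
    up-set lies below [a], hence is comparable with [z], hence lies below [z]. *)
Lemma up_exit z a b : a \in up z -> b \notin up z -> e a b -> b \in A z.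
Proof.
move=> az bz eab; case/orP: (e_lt eab) => [ab|ba].
  by case/negP: bz; apply: up_trans (lt_up ab).
apply/elim_setP; split; last by exists a => //; rewrite e_sym.
have /orP[|zb] := up_chain az (lt_up ba); first by move/(negP bz).
by apply: up_neq_lt zb _; apply: contraNneq bz => ->; apply: up_refl.
Qed.

Lemma conn_up_exit (X : {set T}) z x y : conn e X -> x \in X -> y \in X ->
  x \in up z -> y \notin up z -> exists2 a, a \in X & a \in A z.
Proof.
move=> cX xX yX xz yz.
have [a [b [aX bX az bz eab]]] := conn_exit cX xX yX xz yz.
by exists b => //; apply: up_exit eab.
Qed.

(** An element of least rank is the root: a connected set leaving its up-set would contain, by
    separation, something strictly below it. *)
Lemma conn_min (X : {set T}) : conn e X -> X != set0 -> exists2 r, r \in X & X \subset up r.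
Proof.
move=> cX /set0Pn[x0 x0X]; case: (arg_minnP (rank lt) x0X) => r rX rmin.
exists r => //; apply/subsetP => y yX; apply/negPn/negP => yr.
have [a aX /elim_set_lt ar] := conn_up_exit cX rX yX (up_refl r) yr.
by have := rmin a aX; rewrite leqNgt ltn_rank.
Qed.

(* Erdős–Pósa property of connected sets. The greedy choice takes a bad set
   whose root is as deep as possible: the bag of that root meets every bad set
   meeting its up-set. *)
Lemma erdos_posa (bad : pred {set T}) n (X : {set T}) :
  (exists F : nat -> {set T},
     (forall i, i < n -> [/\ F i \subset X, F i != set0, conn e (F i) & bad (F i)]) /\
     (forall i j, i < j < n -> [disjoint F i & F j])) \/
  (exists Z : {set T}, #|Z| <= n /\
     forall F : {set T}, F \subset X -> F != set0 -> conn e F -> bad F ->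
       exists2 z, z \in Z & ~~ [disjoint F & B z]).
Proof.
elim: n X => [|n IH] X; first by left; exists (fun=> set0); split=> // i j; rewrite andbF.
pose P z := [exists F : {set T},
  [&& F \subset X, F != set0, conn e F, bad F & F \subset up z]].
case: (pickP P) => [z0 Pz0|P0]; last first.
  right; exists set0; rewrite cards0; split=> // F FX F0 cF bF.
  have [r _ Fr] := conn_min cF F0.
  by have /existsP[] := negbT (P0 r); exists F; rewrite FX F0 cF bF.
have [z /existsP[F0 /and5P[F0X F0n cF0 bF0 F0z]] zmax] := arg_maxnP (rank lt) Pz0.
(* Sets found outside the up-set of [z] are disjoint from [F0], which lies inside it. *)
case: (IH (X :\: up z)) => [[F [FP Fd]]|[Z [cZ ZP]]].
  left; exists (fun i => if i < n then F i else F0).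
  split=> [i|i j]; rewrite ltnS => /= le_in.
    case: ifP => // lt_in; have [? ? ? ?] := FP i lt_in; split=> //.
    by apply: subset_trans (subsetDl _ _); eassumption.
  case/andP: le_in => ij jn; have -> : i < n by lia.
  case: ifP => jn'; first by apply: Fd; rewrite ij.
  have [Fi _ _ _] := FP i (leq_trans ij jn).
  apply: disjointWr F0z _; apply: disjointWl Fi _.
  by rewrite disjoints_subset; apply/subsetP => x; rewrite !inE => /andP[].
right; exists (z |: Z); split.
  by rewrite cardsU1; case: (z \notin Z) => /=; lia.
move=> F FX Fn cF bF; case: (boolP [disjoint F & B z]) => [dF|]; last first.
  by exists z => //; rewrite setU11.
case: (boolP [disjoint F & up z]) => [dFz|].
  have FXz : F \subset X :\: up z by rewrite subsetD FX.
  by have [z' z'Z ?] := ZP F FXz Fn cF bF; exists z' => //; rewrite setU1r.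
case/pred0Pn=> x /= /andP[xF xz].
have nA a : a \in F -> a \notin B z by move=> aF; rewrite (disjointFr dF aF).
have Fz : F \subset up z.
  apply/subsetP => y yF; apply/negPn/negP => yz.
  have [a aF aA] := conn_up_exit cF xF yF xz yz.
  by have := nA a aF; rewrite in_setU1 aA orbT.
have [r rF Fr] := conn_min cF Fn.
have zr : lt z r.
  apply: up_neq_lt (subsetP Fz r rF) _; apply/eqP => zr.
  by have := nA r rF; rewrite zr setU11.
have Pr : P r by apply/existsP; exists F; rewrite FX Fn cF bF.
by have := zmax r Pr; rewrite /= leqNgt ltn_rank.
Qed.

(** * Meets in the forest order and separators of bounded size *)

Definition meet_closed (Z : {set T}) : Prop :=
  forall a b, a \in Z -> b \in Z -> exists2 d, d \in Z &
    [/\ a \in up d, b \in up d &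
      forall w, a \in up w -> b \in up w -> d \in up w].

(** Adding a vertex [z] to a meet-closed set costs at most one further vertex: the highest [d] lying
    below both [z] and some [a0] in the set. The meet of [z] with any other [a] is the meet of [d]
    with [a]; both [d] and the meet of [a0] with [a] lie below [a0], so it is the lower of these
    two. The common lower bound [m] makes [d] exist. *)
Lemma meet_closure (Z0 : {set T}) (m : T) : Z0 \subset up m ->
  exists Z : {set T}, [/\ Z0 \subset Z, Z \subset up m, #|Z| <= 2 * #|Z0| & meet_closed Z].
Proof.
move En: #|Z0| => n; elim: n Z0 En => [|n IH] Z0 En Z0m.
  exists set0; rewrite sub0set cards0; split=> //; last by move=> a b; rewrite inE.
  by rewrite subset0 -cards_eq0 En.
have [z zZ0] : exists z, z \in Z0 by apply/set0Pn; rewrite -cards_eq0 En.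
have En' : #|Z0 :\ z| = n by have := cardsD1 z Z0; rewrite zZ0; lia.
have [|Z [ZZ Zm cZ clZ]] := IH _ En'; first by apply: subset_trans Z0m; apply: subD1set.
have zm := subsetP Z0m z zZ0.
have Z0E : Z0 = z |: (Z0 :\ z) by rewrite setD1K.
have [Z_0|/set0Pn[a1 a1Z]] := eqVneq Z set0.
  exists [set z]; split.
  - apply/subsetP => x; rewrite in_set1; apply: contraTT => xz.
    have: x \notin Z0 :\ z by apply/negP => /(subsetP ZZ); rewrite Z_0 inE.
    by rewrite !inE xz.
  - by rewrite sub1set.
  - by rewrite cards1; lia.
  - by move=> a b /set1P-> /set1P->; exists z; rewrite ?set11 ?up_refl.
pose Pd d := (z \in up d) && [exists a in Z, a \in up d].
have Pm : Pd m by rewrite /Pd zm; apply/exists_inP; exists a1; rewrite ?(subsetP Zm).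
have [d /andP[zd /exists_inP[a0 a0Z a0d]] dmax] := arg_maxnP (rank lt) Pm.
have dP w a : a \in Z -> z \in up w -> a \in up w -> d \in up w.
  move=> aZ zw aw; have /orP[dw|//] := up_chain zd zw; rewrite in_up.
  have [//|ne] := eqVneq w d.
  have dw' : lt d w by apply: up_neq_lt; rewrite // eq_sym.
  have Pw : Pd w by rewrite /Pd zw; apply/exists_inP; exists a.
  by have := dmax w Pw; rewrite /= leqNgt ltn_rank.
have meet_d a : a \in Z -> exists2 l, l \in z |: (d |: Z) &
    [/\ d \in up l, a \in up l & forall w, d \in up w -> a \in up w -> l \in up w].
  move=> aZ; have [l lZ [a0l al lP]] := clZ _ _ a0Z aZ.
  case/orP: (up_chain a0d a0l) => [ld|dl]; last first.
    exists l; first by rewrite !in_setU1 lZ !orbT.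
    by split=> // w dw aw; apply: lP => //; apply: up_trans a0d.
  exists d; first by rewrite !inE eqxx !orbT.
  by split; rewrite ?up_refl //; apply: up_trans al.
have meet_z a : a \in Z -> exists2 l, l \in z |: (d |: Z) &
    [/\ z \in up l, a \in up l & forall w, z \in up w -> a \in up w -> l \in up w].
  move=> aZ; have [l lZ [dl al lP]] := meet_d a aZ; exists l => //; split=> //.
    exact: up_trans dl zd.
  by move=> w zw aw; apply: lP => //; apply: dP zw aw.
exists (z |: (d |: Z)); split.
- rewrite {1}Z0E.
  apply: setUS.
  by apply: (subset_trans ZZ); apply: subsetUr.
- have dm : d \in up m by apply: (dP _ _ a1Z zm); apply: (subsetP Zm).
  by rewrite subUset sub1set zm subUset sub1set dm.
- by rewrite !cardsU1; case: (z \notin _); case: (d \notin _) => /=; lia.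
- have meetC a b l : [/\ a \in up l, b \in up l & forall w, a \in up w -> b \in up w -> l \in up w]
    -> [/\ b \in up l, a \in up l & forall w, b \in up w -> a \in up w -> l \in up w].
    by case=> al bl lP; split=> // w bw aw; apply: lP.
  have self x : x \in z |: (d |: Z) -> exists2 l, l \in z |: (d |: Z) &
    [/\ x \in up l, x \in up l & forall w, x \in up w -> x \in up w -> l \in up w].
    by move=> xZ; exists x; rewrite ?up_refl.
  have zZ' : z \in z |: (d |: Z) by rewrite setU11.
  have dZ' : d \in z |: (d |: Z) by rewrite !inE eqxx !orbT.
  have zdm : exists2 l, l \in z |: (d |: Z) &
    [/\ z \in up l, d \in up l & forall w, z \in up w -> d \in up w -> l \in up w].
    by exists d; rewrite ?up_refl.
  move=> a b; rewrite 2!in_setU1 => /or3P[/eqP->|/eqP->|aZ];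
    rewrite 2!in_setU1 => /or3P[/eqP->|/eqP->|bZ].
  + exact: self. + exact: zdm. + exact: meet_z.
  + by have [l ? /meetC ?] := zdm; exists l. + exact: self. + exact: meet_d.
  + by have [l ? /meetC ?] := meet_z a aZ; exists l.
  + by have [l ? /meetC ?] := meet_d a aZ; exists l.
  + by have [l lZ ?] := clZ a b aZ bZ; exists l; rewrite // !in_setU1 lZ !orbT.
Qed.

(** Let [r] be the root of [Y] and [u] the highest element of [Z] below [r]. Let [p] be the least
    element of [Z] above some [w] with [u < w <= r], which closure under meets provides, or [u] if
    there is none. Everything [Y] sees in [Q] lies in the bags of [u] and [p]. *)
Lemma card_bdry_separator k (X Z Y : {set T}) m :
  (forall v, #|A v| <= k) -> m \in Z -> X \subset up m -> meet_closed Z ->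
  let Q := X :&: \bigcup_(z in Z) B z in
  Y \subset X :\: Q -> Y != set0 -> conn e Y -> #|bdry e Y :&: Q| <= 2 * k.+1.
Proof.
move=> Ak mZ Xm Zcl Q YXQ Yn cY.
have cardB v : #|B v| <= k.+1 by rewrite cardsU1; have := Ak v; case: (v \notin _) => /=; lia.
have [r rY Yr] := conn_min cY Yn.
have YX y : y \in Y -> y \in X by move/(subsetP YXQ); rewrite inE => /andP[].
have YB y z : y \in Y -> z \in Z -> y \notin B z.
  move=> yY zZ; have := subsetP YXQ y yY; rewrite inE => /andP[yQ yX].
  by apply: contra yQ => yB; rewrite inE yX; apply/bigcupP; exists z.
have rZ z : z \in Z -> z != r.
  by move=> zZ; apply/eqP => zr; have := YB r z rY zZ; rewrite zr setU11.
pose Pu u := (u \in Z) && lt u r.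
have Pm : Pu m.
  have rm : r \in up m by apply: (subsetP Xm); apply: YX.
  by rewrite /Pu mZ; apply: up_neq_lt rm (rZ m mZ).
have [u /andP[uZ ur] umax] := arg_maxnP (rank lt) Pm.
have noZ z : z \in Z -> lt u z -> r \in up z -> False.
  move=> zZ uz rz; have Pz : Pu z by rewrite /Pu zZ; apply: (up_neq_lt rz); apply: rZ.
  by have := umax z Pz; rewrite /= leqNgt ltn_rank.
have noY z y : z \in Z -> y \in Y -> z \in up r -> y \in up z -> False.
  move=> zZ yY zr yz.
  have rz : r \notin up z.
    apply: lt_nup; apply: (up_neq_lt zr); rewrite eq_sym; exact: rZ.
  have [a aY aA] := conn_up_exit cY yY rY yz rz.
  by have := YB a z aY zZ; rewrite in_setU1 aA orbT.
pose Pz z := (z \in Z) && [exists w, [&& lt u w, r \in up w & z \in up w]].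
have [p pZ pP] : exists2 p, p \in Z & forall z, Pz z -> lt u p /\ z \in up p.
  case: (pickP Pz) => [z0 Pz0|Pz0]; last by exists u => // z; rewrite Pz0.
  have [p /andP[pZ /existsP[w1 /and3P[uw1 rw1 pw1]]] pmin] := arg_minnP (rank lt) Pz0.
  exists p => // z /andP[zZ /existsP[w2 /and3P[uw2 rw2 zw2]]].
  split; first exact: lt_up_lt uw1 pw1.
  have [l lZ [pl zl lP]] := Zcl p z pZ zZ.
  (* Both witnesses lie at or below [r], so they are comparable and the lower one serves for [p] and
     [z] alike. *)
  have [w [uw rw pw zw]] : exists w, [/\ lt u w, r \in up w, p \in up w & z \in up w].
    case/orP: (up_chain rw1 rw2) => [w21|w12].
      by exists w1; split=> //; apply: up_trans w21 zw2.
    by exists w2; split=> //; apply: up_trans w12 pw1.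
  have lw := lP w pw zw.
  have Pl : Pz l by rewrite /Pz lZ; apply/existsP; exists w; rewrite uw rw lw.
  have [<-//|ne] := eqVneq l p.
  have := pmin l Pl; rewrite leqNgt ltn_rank //.
  exact: up_neq_lt pl ne.
have Pz_r z : z \in Z -> z \in up r -> Pz z.
  by move=> zZ zr; rewrite /Pz zZ; apply/existsP; exists r; rewrite ur up_refl.
apply: leq_trans (_ : #|B u :|: B p| <= _); last first.
  by apply: leq_trans (leq_card_setU _ _) _; have := cardB u; have := cardB p; lia.
apply: subset_leq_card; apply/subsetP => q; rewrite in_setI => /andP[/bdryP[qY [y yY eyq]]].
rewrite inE => /andP[qX /bigcupP[z zZ qz]].
have zq : z \in up q.
  by move: qz; rewrite in_setU1 => /orP[/eqP->|/elim_set_lt/lt_up]; rewrite ?up_refl.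
have qA x : lt q x -> lt q z -> z \in up x -> q \in A x.
  move=> qx ltqz zx; apply: (elim_set_down _ qx zx).
  by move: qz; rewrite in_setU1 => /orP[/eqP E|//]; move: ltqz; rewrite E lt_irr.
have yr := subsetP Yr y yY.
rewrite in_setU !in_setU1.
have goodp : lt u p -> z \in up p -> p \in up q -> (q == p) || (q \in A p).
  move=> ltup zp pq; have [//|ne] := eqVneq q p.
  have lqp := up_neq_lt pq ne; rewrite qA //; exact: lt_up_lt zp.
have above : q \in up r -> [/\ lt u p, z \in up p & p \in up r].
  move=> qr; have zr := up_trans qr zq; have [ltup zp] := pP z (Pz_r z zZ zr).
  split=> //; case/orP: (up_chain zr zp) => // rp; by case: (noZ p).
(* If [q] is at or above [r], or between [u] and [r], then [p] is at or below [z] and [q] belongs to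
   the bag of [p]; if [q] is at or below [u], it belongs to the bag of [u]. Any other position of
   [p] puts a vertex of [Y] into a bag, lets [Y] cross one, or puts an element of [Z] between [u]
   and [r]. *)
case/orP: (e_lt eyq) => [yq|qy].
  have [ltup zp pr] := above (up_trans yr (lt_up yq)).
  case/orP: (up_chain zp zq) => [qp|pq]; last by rewrite goodp ?orbT.
  case/orP: (up_chain qp (lt_up yq)) => [yp|py]; first by case: (noY p y).
  have [yEp|ne] := eqVneq y p; first by have := YB y p yY pZ; rewrite yEp setU11.
  have yA : y \in A p by apply/elim_setP; split; [exact: up_neq_lt py ne|exists q].
  by have := YB y p yY pZ; rewrite in_setU1 yA orbT.
case/orP: (up_chain yr (lt_up qy)) => [qr|rq].
  have [ltup zp pr] := above qr.
  case/orP: (up_chain zp zq) => [qp|pq]; last by rewrite goodp ?orbT.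
  by case: (noY p y) => //; apply: up_trans (lt_up qy).
case/orP: (up_chain rq (lt_up ur)) => [qu|uq].
  have [//|ne] := eqVneq q u.
  have -> // : q \in A u.
  apply/elim_setP; split; first exact: up_neq_lt.
  by exists y; [apply: up_trans (lt_up ur) yr|rewrite e_sym].
have [-> //|ne] := eqVneq q u.
have luq : lt u q by apply: (up_neq_lt uq); rewrite eq_sym.
have Pzz : Pz z by rewrite /Pz zZ; apply/existsP; exists q; rewrite luq rq zq.
have [ltup zp] := pP z Pzz.
case/orP: (up_chain zp zq) => [qp|pq]; last by rewrite goodp ?orbT.
by case: (noZ p) => //; apply: up_trans rq.
Qed.

Lemma separator k n (X : {set T}) (bad : pred {set T}) :
  (forall v, #|A v| <= k) -> conn e X -> X != set0 ->
  ~ (exists F : nat -> {set T},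
     (forall i, i < n -> [/\ F i \subset X, F i != set0, conn e (F i) & bad (F i)]) /\
     (forall i j, i < j < n -> [disjoint F i & F j])) ->
  exists Q : {set T}, [/\ Q \subset X, Q != set0, #|Q| <= 2 * n.+1 * k.+1 &
    forall Y : {set T}, Y \subset X :\: Q -> Y != set0 -> conn e Y ->
      ~~ bad Y /\ #|bdry e Y :&: Q| <= 2 * k.+1].
Proof.
move=> Ak cX Xn nF; have [m mX Xm] := conn_min cX Xn.
case: (erdos_posa bad n X) => // -[Z0 [cZ0 Z0P]].
have [|Z [Z0Z Zm cZ Zcl]] := @meet_closure (m |: (Z0 :&: up m)) m.
  by rewrite subUset sub1set up_refl subsetIr.
have mZ : m \in Z by apply: (subsetP Z0Z); rewrite setU11.
have cardB v : #|B v| <= k.+1 by rewrite cardsU1; have := Ak v; case: (v \notin _) => /=; lia.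
exists (X :&: \bigcup_(z in Z) B z); split; first exact: subsetIl.
- by apply/set0Pn; exists m; rewrite inE mX; apply/bigcupP; exists m; rewrite // setU11.
- apply: leq_trans (subset_leq_card (subsetIr _ _)) _.
  apply: leq_trans (card_bigcup_leq _ cardB) _.
  rewrite leq_mul2r; apply/orP; right; apply: leq_trans cZ _.
  rewrite leq_mul2l cardsU1 /=.
  have := subset_leq_card (subsetIl Z0 (up m)); case: (m \notin _) => /=; lia.
move=> Y YX Yn cY; split; last exact: card_bdry_separator Ak mZ Xm Zcl YX Yn cY.
have YX' : Y \subset X by apply: subset_trans YX (subsetDl _ _).
apply/negP => bY; have [z zZ0 /pred0Pn[x /= /andP[xY xz]]] := Z0P Y YX' Yn cY bY.
have xX := subsetP YX' x xY.
have zx : z \in up x.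
  by move: xz; rewrite in_setU1 => /orP[/eqP->|/elim_set_lt/lt_up]; rewrite ?up_refl.
have zZ : z \in Z.
  by apply: (subsetP Z0Z); rewrite !inE zZ0 -in_up (up_trans (subsetP Xm x xX) zx) orbT.
have := subsetP YX x xY; rewrite inE => /andP[/negP[]]; rewrite inE xX.
by apply/bigcupP; exists z.
Qed.

End ElimTheory.

(** * Partitions from disjointedness *)

Lemma pigeonhole (I U : finType) (f : I -> U) (S : {set U}) b :
  (forall i, f i \in S) -> b * #|S| < #|I| ->
  exists2 u, u \in S & b < #|[set i | f i == u]|.
Proof.
move=> fS ltb; apply/exists_inP; apply: contraLR ltb => /exists_inPn noU.
rewrite -leqNgt -[#|I|]sum1_card (partition_big f (mem S)) /=; last by move=> i _; apply: fS.
rewrite mulnC -sum_nat_const; apply: leq_sum => u uS.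
by have := noU u uS; rewrite -leqNgt sum1_card cardsE.
Qed.

(* A perfect elimination scheme: [nb h] is the set of neighbours of [h]
   eliminated after it, and [tau] is the reverse of the elimination order. *)
Definition elim_scheme (U : finType) (nb : U -> {set U}) (tau : U -> nat) (c : nat) : Prop :=
  [/\ forall a h, a \in nb h -> tau a < tau h,
      forall h a b, a \in nb h -> b \in nb h -> a != b -> (a \in nb b) || (b \in nb a) &
      forall h, #|nb h| <= c].

Definition disjointed (T : finType) (e : rel T) (c n : nat) : Prop :=
  forall (X : {set T}) (v : 'I_c -> T) (F : nat -> {set T}),
    conn e X -> injective v -> (forall l, v l \notin X) ->
    (forall i, i < n -> [/\ F i \subset X, F i != set0, conn e (F i) &
                            forall l, adj e (F i) (v l)]) ->
    (forall i j, i < j < n -> [disjoint F i & F j]) -> False.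

Section Partition.
Variables (T : finType) (e lt : rel T) (k c n : nat).
Hypothesis e_sym : symmetric e.
Hypothesis e_elim : elim_order e lt k.
Hypothesis e_disj : disjointed e c n.

(** [s] bounds how much of one part a component sees and [W] the size of a part; both are the values
    given by [separator] for families of [n.+1 * s ^ c] sets. *)
Let s := 2 * k.+1.
Let W := 2 * (n.+1 * s ^ c).+1 * k.+1.

(** Each set of the family picks a neighbour in each of the [c] parts, in at most [s ^ c] ways
    altogether. By pigeonhole more than [n] of the sets pick the same [c] vertices, against
    disjointedness. *)
Lemma few_bad_sets (X : {set T}) (part : T -> T) :
  conn e X ->
  #|part @: bdry e X| = c ->
  (forall h, #|[set u in bdry e X | part u == h]| <= s) ->
  ~ exists F : nat -> {set T},
     (forall i, i < n.+1 * s ^ c -> [/\ F i \subset X, F i != set0, conn e (F i) &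
        [forall h in part @: bdry e X, [exists u in bdry e X, (part u == h) && adj e (F i) u]]]) /\
     (forall i j, i < j < n.+1 * s ^ c -> [disjoint F i & F j]).
Proof.
move=> cX cN fib [F [FP Fd]].
pose name (l : 'I_c) : T := enum_val (cast_ord (esym cN) l).
have name_in l : name l \in part @: bdry e X by apply: enum_valP.
have name_inj : injective name by move=> l l' /enum_val_inj/cast_ord_inj.
have phiP (i : 'I_(n.+1 * s ^ c)) : exists f : {ffun 'I_c -> T},
    forall l, (f l \in [set u in bdry e X | part u == name l]) && adj e (F i) (f l).
  have [_ _ _ /forall_inP bF] := FP i (ltn_ord i).
  have ex l : exists u, (u \in [set u in bdry e X | part u == name l]) && adj e (F i) u.
    have /exists_inP[u uX /andP[pu au]] := bF _ (name_in l).
    by exists u; rewrite inE uX pu au.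
  have [g gP] := fin_all_exists ex; exists [ffun l => g l] => l.
  by rewrite ffunE gP.
have [phi phiE] := fin_all_exists phiP.
pose S := [set f : {ffun 'I_c -> T} |
  f \in family (fun l => [set u in bdry e X | part u == name l])].
have phiS i : phi i \in S.
  by rewrite inE; apply/familyP => l; case/andP: (phiE i l).
have cS : #|S| <= s ^ c.
  rewrite cardsE card_family foldrE big_map.
  have -> : s ^ c = \prod_(l <- enum 'I_c) s by rewrite big_const_seq count_predT size_enum_ord iter_muln_1.
  rewrite big_enum_cond big_enum_cond /=.
  by apply: leq_prod => l _; apply: fib.
have s0 : 0 < s ^ c by rewrite expn_gt0.
have [|u uS bigu] := pigeonhole (b := n) phiS.
  rewrite card_ord; apply: leq_ltn_trans (_ : n * s ^ c < _).
    by rewrite leq_mul2l cS orbT.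
  by rewrite ltn_mul2r s0 ltnSn.
set I0 := [set i | phi i == u] in bigu.
pose idx i := nth 0 (map val (enum I0)) i.
have sz : size (map val (enum I0)) = #|I0| by rewrite size_map -cardE.
have idxP i : i < n -> exists2 j : 'I_(n.+1 * s ^ c), j \in I0 & idx i = j.
  move=> lt_in; have : idx i \in map val (enum I0).
    by rewrite mem_nth // sz; apply: ltn_trans bigu.
  by case/mapP => j; rewrite mem_enum => jI ->; exists j.
apply: (e_disj (X := X) (v := fun l => u l) (F := fun i => F (idx i))) => //.
- move=> l l' E; apply: name_inj.
  move: uS; rewrite inE => /familyP uf.
  have := uf l; have := uf l'; rewrite !inE E => /andP[_ /eqP<-] /andP[_ /eqP<-] //.
- move=> l; move: uS; rewrite inE => /familyP/(_ l); rewrite inE => /andP[/bdryP[]] //.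
- move=> i lt_in; have [j jI ->] := idxP i lt_in.
  have [? ? ? _] := FP j (ltn_ord j); split=> // l.
  by move: jI; rewrite inE => /eqP <-; case/andP: (phiE j l).
- move=> i j /andP[ij jn].
  have ne : idx i != idx j.
    have uI : uniq (map val (enum I0)) by rewrite map_inj_uniq ?enum_uniq //; apply: val_inj.
    by rewrite nth_uniq ?sz //; lia.
  have [i' _ Ei] := idxP i (ltn_trans ij jn); have [j' _ Ej] := idxP j jn.
  move: ne; rewrite Ei Ej neq_ltn => /orP[lt_ij|lt_ji].
    by apply: Fd; rewrite lt_ij ltn_ord.
  by rewrite disjoint_sym; apply: Fd; rewrite lt_ji ltn_ord.
Qed.

(** The invariant for the boundary [S] of a component still to be partitioned. Its parts form a
    clique of size at most [c], so a new part joined to all of them preserves the elimination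
    scheme. *)
Definition good_roots (nb : T -> {set T}) (part : T -> T) (S : {set T}) : Prop :=
  [/\ forall a b, a \in part @: S -> b \in part @: S -> a != b -> (a \in nb b) || (b \in nb a),
      #|part @: S| <= c & forall h, #|[set u in S | part u == h]| <= s].

(** Parts are named by vertices of [D]. The bound on [tau] lets a new part take the value [#|D|],
    above all earlier ones. *)
Definition partial_partition (D : {set T}) nb tau (part : T -> T) : Prop :=
  [/\ elim_scheme nb tau c,
      (forall v, v \in D -> part v \in D) /\ (forall h, nb h \subset D),
      (forall h, h \in D -> tau h < #|D|) /\
        (forall h, #|[set v in D | part v == h]| <= W),
      (forall u v, u \in D -> v \in D -> e u v ->
         [|| part u == part v, part u \in nb (part v) | part v \in nb (part u)]) &
      forall x, x \notin D -> good_roots nb part (bdry e (comp e (~: D) x))].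

Lemma good_roots_sub nb part (S S' : {set T}) :
  S' \subset S -> good_roots nb part S -> good_roots nb part S'.
Proof.
move=> sS [cl cN fib]; have sP := imsetS part sS; split.
- by move=> a b /(subsetP sP) aS /(subsetP sP) bS; apply: cl.
- exact: leq_trans (subset_leq_card sP) cN.
- move=> h; apply: leq_trans (fib h); apply: subset_leq_card.
  by apply/subsetP => u; rewrite !inE => /andP[/(subsetP sS)-> ->].
Qed.

Lemma extend_partition D nb tau part x :
  partial_partition D nb tau part -> x \notin D ->
  exists (D' : {set T}) nb' tau' part', D \proper D' /\ partial_partition D' nb' tau' part'.
Proof.
case=> [[tauP clP nbc]] [partD nbD] [tauD fibD] edgeD rootD xD.
have [lt_forest e_lt Ak] := e_elim.
have xD' : x \in ~: D by rewrite inE.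
pose X := comp e (~: D) x.
have XD : X \subset ~: D by apply: comp_sub.
have cX : conn e X by apply: comp_conn.
have Xn : X != set0 by apply/set0Pn; exists x; apply: comp_self.
have [rcl rc rfib] := rootD x xD; rewrite -/X in rcl rc rfib.
set S := bdry e X in rcl rc rfib.
have SD : S \subset D.
  apply/subsetP => u /bdryP[uX [y yX eyu]]; apply/negPn/negP => uD.
  by case/negP: uX; apply: (comp_closed xD' yX); rewrite ?inE.
(* If [X] sees fewer than [c] parts, no set is bad: there is room for one more part, and [separator]
   still yields a nonempty [Q]. *)
pose bad (F : {set T}) := (#|part @: S| == c) &&
  [forall h in part @: S, [exists u in S, (part u == h) && adj e F u]].
have [|Q [QX Qn cQ QP]] :=
    @separator _ _ _ e_sym lt_forest e_lt k (n.+1 * s ^ c) X bad Ak cX Xn.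
  case=> F [FP Fd]; have [cN|cN] := eqVneq #|part @: S| c; last first.
    have s0 : 0 < n.+1 * s ^ c by rewrite muln_gt0 expn_gt0.
    by have [_ _ _] := FP 0 s0; rewrite /bad (negPf cN).
  apply: (few_bad_sets cX cN rfib); exists F; split=> // i /FP[? ? ? /andP[_ ?]] //.
have [q qQ] := set0Pn _ Qn.
have QD y : y \in Q -> y \notin D.
  by move=> yQ; have := subsetP XD y (subsetP QX y yQ); rewrite inE.
have qD := QD q qQ.
have neq_q a : a \in D -> (a == q) = false by move=> aD; apply: contraNF qD => /eqP<-.
exists (D :|: Q), (fun h => if h == q then part @: S else nb h),
  (fun h => if h \in Q then #|D| else tau h), (fun v => if v \in Q then q else part v).
have DQ v : v \in D -> (v \in Q) = false.
  by move=> vD; apply/negP => /QD; rewrite vD.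
have pS : part @: S \subset D.
  by apply/subsetP => a /imsetP[u uS ->]; apply/partD/(subsetP SD).
have ltD : #|D| < #|D :|: Q|.
  apply: proper_card; apply/properP; split; first exact: subsetUl.
  by exists q; rewrite // inE qQ orbT.
split.
  apply/properP; split; first exact: subsetUl.
  by exists q; rewrite // inE qQ orbT.
split.
- split.
  + move=> a h ah'.
    have aD : a \in D by move: ah'; case: (h == q) => [/(subsetP pS)|/(subsetP (nbD h))].
    rewrite DQ //; have [hQ|hQ] := boolP (h \in Q); first exact: tauD.
    have [hq|hq] := eqVneq h q; first by rewrite hq qQ in hQ.
    by apply: tauP; rewrite (negPf hq) in ah'.
  + move=> h a b; case: (h == q) => [aS bS|ah bh].
      by rewrite !neq_q ?(subsetP pS) //; apply: rcl.
    by rewrite !neq_q ?(subsetP (nbD h)) //; apply: clP ah bh.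
  + by move=> h; case: (h == q).
- split=> [v|h].
    rewrite !inE => /orP[vD|vQ]; first by rewrite DQ // partD.
    by rewrite vQ qQ orbT.
  apply: subset_trans (subsetUl _ _); by case: (h == q).
- split=> h.
    by rewrite inE => /orP[hD|->//]; rewrite DQ //; apply: ltn_trans (tauD h hD) ltD.
  have [->|hq] := eqVneq h q.
    apply: leq_trans cQ; apply: subset_leq_card; apply/subsetP => v.
    rewrite !inE; case: ifP => [|_ /andP[]] //.
    by rewrite orbF => vD; rewrite neq_q // partD.
  apply: leq_trans (fibD h); apply: subset_leq_card; apply/subsetP => v.
  by rewrite !inE; case: ifP => [_|_]; rewrite ?orbF // eq_sym (negPf hq) andbF.
- have cross u v : u \in D -> v \in Q -> e u v -> part u \in part @: S.
    move=> uD vQ euv; apply/imsetP; exists u => //; apply/bdryP; split.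
      by apply/negP => /(subsetP XD); rewrite inE uD.
    by exists v; rewrite ?(subsetP QX) // e_sym.
  move=> u v; rewrite !inE => /orP[uD|uQ] /orP[vD|vQ] euv.
  + by rewrite !DQ // !neq_q ?partD //; apply: edgeD.
  + by rewrite (DQ u) // vQ eqxx (cross u v) // orbT.
  + by rewrite (DQ v) // uQ eqxx (cross v u) ?orbT // e_sym.
  + by rewrite uQ vQ eqxx.
- move=> y; rewrite inE negb_or => /andP[yD yQ].
  have yD' : y \in ~: D by rewrite inE.
  have yDQ : y \in ~: (D :|: Q) by rewrite !inE negb_or yD.
  set Y := comp e _ y.
  have YD : Y \subset ~: (D :|: Q) by apply: comp_sub.
  have cY : conn e Y by apply: comp_conn.
  have yY : y \in Y by apply: comp_self.
  have YDQ : bdry e Y \subset D :|: Q.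
    apply/subsetP => u /bdryP[uY [z zY ezu]]; apply/negPn/negP => uDQ.
    by case/negP: uY; apply: (comp_closed yDQ zY); rewrite ?inE // -in_setU.
  have YsubD : Y \subset ~: D by apply: subset_trans YD _; rewrite setCS subsetUl.
  (* A neighbour of [Q] outside [D] belongs to [X]. So a component [Y] outside [X] does not see [Q]
     and inherits the invariant from a component for [D]. *)
  have [yX|yX] := boolP (y \in X); last first.
    have YX : [disjoint Y & X].
      apply/pred0P => z /=; apply/negP => /andP[zY zX]; case/negP: yX.
      have YZ : Y \subset comp e (~: D) y by apply: conn_sub_comp cY YsubD yY.
      by rewrite /X -(comp_eq e_sym zX) (comp_eq e_sym (subsetP YZ z zY)) comp_self.
    have YS : bdry e Y \subset bdry e (comp e (~: D) y).
      apply/subsetP => u uB; have uDQ := subsetP YDQ u uB.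
      case/bdryP: uB => uY [z zY ezu].
      have zY' : z \in comp e (~: D) y by apply: (subsetP (conn_sub_comp cY YsubD yY)).
      have uD : u \in D.
        move: uDQ; rewrite in_setU => /orP[//|uQ].
        have zX : z \in X.
          apply: (comp_closed xD' (subsetP QX u uQ)); first exact: (subsetP YsubD).
          by rewrite e_sym.
        by have := disjointFr YX zY; rewrite zX.
      apply/bdryP; split; last by exists z.
      by apply/negP => /(subsetP (comp_sub e yD')); rewrite inE uD.
    have [cl cN fib] := good_roots_sub YS (rootD y yD).
    have BD u : u \in bdry e Y -> u \in D.
      move=> /(subsetP YS) /bdryP[uY [z zY ezu]]; apply/negPn/negP => uD.
      by case/negP: uY; apply: (comp_closed yD' zY); rewrite ?inE.
    have pE : [set (if u \in Q then q else part u) | u in bdry e Y] = part @: bdry e Y.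
      by apply: eq_in_imset => u /BD uD; rewrite DQ.
    split; rewrite ?pE //.
      move=> a b aS bS; have aD : a \in D by case/imsetP: aS => u /BD uD ->; apply: partD.
      have bD : b \in D by case/imsetP: bS => u /BD uD ->; apply: partD.
      by rewrite !neq_q //; apply: cl.
    move=> h; apply: leq_trans (fib h); apply: subset_leq_card; apply/subsetP => u.
    by move=> /setIdP[uB pu]; apply/setIdP; rewrite DQ ?BD in pu.
  have YX : Y \subset X.
    by rewrite /X -(comp_eq e_sym yX); apply: conn_sub_comp cY YsubD yY.
  have YXQ : Y \subset X :\: Q.
    rewrite subsetD YX /=; apply/pred0P => z /=; apply/negP => /andP[/(subsetP YD)].
    by rewrite !inE negb_or => /andP[_ /negP].
  have Yn : Y != set0 by apply/set0Pn; exists y.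
  have [nbad cYQ] := QP Y YXQ Yn cY.
  have YS u : u \in bdry e Y -> u \notin Q -> u \in S.
    move=> uB uQ; have := subsetP YDQ u uB; rewrite in_setU (negPf uQ) orbF => uD.
    case/bdryP: uB => _ [z zY ezu]; apply/bdryP; split.
      by apply/negP => /(subsetP XD); rewrite inE uD.
    by exists z; rewrite ?(subsetP YX).
  set part' := fun v => if v \in Q then q else part v.
  have pY a : a \in part' @: bdry e Y -> a = q \/ a \in part @: S.
    case/imsetP=> u uB ->; rewrite /part'; case: ifP => uQ; first by left.
    by right; apply: imset_f; apply: YS; rewrite ?uQ.
  split.
  + move=> a b /pY[->|aS] /pY[->|bS]; rewrite ?eqxx //.
    * by rewrite bS orbC.
    * by rewrite aS.
    by rewrite !neq_q ?(subsetP pS) //; apply: rcl.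
  + have sub : part' @: bdry e Y \subset q |: part @: S.
      by apply/subsetP => a /pY[->|aS]; rewrite in_setU1 ?eqxx ?aS ?orbT.
    have qS : q \notin part @: S by apply: contra qD => /(subsetP pS).
    have := subset_leq_card sub; rewrite cardsU1 qS add1n.
    have [cN|cN] := eqVneq #|part @: S| c; last first.
      by move/leq_trans; apply; rewrite ltn_neqAle cN.
    (* Seeing [c.+1] parts means seeing [Q] and every part seen by [X], which would make [Y] bad. *)
    rewrite cN leq_eqVlt ltnS => /orP[/eqP full|//]; case/negP: nbad.
    have Efull : part' @: bdry e Y = q |: part @: S.
      apply/eqP; rewrite eqEcard sub cardsU1 qS add1n cN.
      by rewrite full leqnn.
    rewrite /bad cN eqxx; apply/forall_inP => h hS.
    have : h \in part' @: bdry e Y by rewrite Efull in_setU1 hS orbT.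
    case/imsetP => u uB; rewrite /part'; case: ifP => uQ hE.
      by rewrite hE (negPf qS) in hS.
    apply/exists_inP; exists u; first by apply: YS; rewrite ?uQ.
    by rewrite -hE eqxx; move: uB; rewrite inE => /andP[].
  + move=> h; have [->|hq] := eqVneq h q.
      apply: leq_trans cYQ; apply: subset_leq_card; apply/subsetP => u.
      move=> /setIdP[uB]; rewrite /part' in_setI uB; case: ifP => // uQ /eqP pq.
      have uS := YS u uB (negbT uQ).
      by have := neq_q _ (partD u (subsetP SD u uS)); rewrite pq eqxx.
    apply: leq_trans (rfib h); apply: subset_leq_card; apply/subsetP => u.
    move=> /setIdP[uB]; rewrite /part'; case: ifP => [_|uQ pu]; first by rewrite eq_sym (negPf hq).
    by apply/setIdP; rewrite YS ?uQ.
Qed.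

Lemma bounded_elim_partition : exists (nb : T -> {set T}) (tau : T -> nat) (part : T -> T),
  [/\ elim_scheme nb tau c,
      forall u v, e u v -> [|| u == v, part u == part v, part u \in nb (part v) | part v \in nb (part u)] &
      forall h, #|[set v | part v == h]| <= W].
Proof.
suff [nb [tau [part [sch _ [_ fib] edge _]]]] :
  exists nb tau part, partial_partition setT nb tau part.
  exists nb, tau, part; split=> //.
    by move=> u v euv; rewrite edge ?inE ?orbT.
  by move=> h; apply: leq_trans (fib h); apply: subset_leq_card; apply/subsetP => v; rewrite !inE.
have: exists (D : {set T}) nb tau part, partial_partition D nb tau part.
  exists set0, (fun=> set0), (fun=> 0), id; split.
  - by split=> [a h|h a b|h]; rewrite ?inE ?cards0.
  - by split=> [v|h]; rewrite ?inE.
  - split=> h; rewrite ?inE //.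
    by rewrite (eq_card0 (_ : _ =i pred0)) // => v; rewrite !inE.
  - by move=> u v; rewrite inE.
  - move=> x _; set S := bdry _ _.
    have -> : S = set0.
      apply/eqP/negPn/negP => /set0Pn[u /bdryP[uY [z zY ezu]]].
      by case/negP: uY; apply: (comp_closed _ zY); rewrite ?inE.
    split.
    + by move=> a b; rewrite imset0 inE.
    + by rewrite imset0 cards0.
    + by move=> h; rewrite (eq_card0 (_ : _ =i pred0)) // => v; rewrite !inE.
case=> D; move En: #|~: D| => m; elim/ltn_ind: m D En => m IH D En [nb [tau [part P]]].
have [DT|/subsetPn[x _ xD]] := boolP (setT \subset D).
  by exists nb, tau, part; move: DT P; rewrite subTset => /eqP->.
have [D' [nb' [tau' [part' [DD' P']]]]] := extend_partition P xD.
apply: (IH #|~: D'| _ D') => //; last by exists nb', tau', part'.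
by rewrite -En; apply: proper_card; rewrite properC ?setCK.
Qed.
End Partition.

(** * Tree decompositions and elimination orders *)

(** At a vertex of greatest height on a cycle, both neighbours on the cycle are its parent, hence
    equal. *)
Lemma parent_acyclic (I : finType) (P : rel I) (ht : I -> nat) (c : seq I) :
  (forall i j, P i j -> ht j < ht i) ->
  (forall i j j', P i j -> P i j' -> j = j') ->
  ucycle [rel i j | P i j || P j i] c -> size c <= 2.
Proof.
move=> Pht Pfun /andP[cyc un]; rewrite leqNgt; apply/negP => sz.
have [x0 x0c] : exists x, x \in c by case: c sz {cyc un} => // x c _; exists x; rewrite mem_head.
have [x xc xmax] := arg_maxnP ht x0c.
have [i p cE] := rot_to xc.
have {}cyc : cycle [rel i j | P i j || P j i] (x :: p) by rewrite -cE rot_cycle.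
have {}un : uniq (x :: p) by rewrite -cE rot_uniq.
move: cyc un; have: size (x :: p) > 2 by rewrite -cE size_rot.
have pmax y : y \in p -> ht y <= ht x.
  move=> yp; apply: xmax; have : y \in rot i c by rewrite cE inE yp orbT.
  by rewrite mem_rot.
case: p pmax {cE} => [//|y p] pmax szp.
case: (lastP p) pmax szp => [//|q z] pmax _.
rewrite /= -cats1 !cats1 rcons_path last_rcons => /andP[Exy /andP[_ Ezx]].
rewrite mem_rcons !inE => /and3P[_ ]; rewrite negb_or => /andP[/eqP yz _] _.
have {}Exy : P x y.
  by case/orP: Exy => // /Pht; rewrite ltnNge pmax ?mem_head.
have {}Ezx : P x z.
  by case/orP: Ezx => // /Pht; rewrite ltnNge pmax // inE mem_rcons mem_head orbT.
exact: yz (Pfun _ _ _ Exy Ezx).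
Qed.

(** The bag of [h] is [h |: nb h], and the parent of [h] is the member [p] of [nb h] with greatest
    [tau]; the clique condition puts the rest of [nb h] into [nb p]. The extra node [None], with
    empty bag, joins the resulting forest into a tree. *)
Lemma elim_scheme_tw_le (U : finType) (e : rel U) (nb : U -> {set U}) tau c :
  elim_scheme nb tau c ->
  (forall u v, e u v -> (u \in nb v) || (v \in nb u)) -> tw_le e c.
Proof.
move=> [tauP clP nbc] enb.
pose par h := [pick a in nb h | [forall b in nb h, tau b <= tau a]].
have parS h p : par h = Some p -> p \in nb h /\ forall b, b \in nb h -> tau b <= tau p.
  by rewrite /par; case: pickP => // a /andP[ah /forall_inP amax] [<-].
have parN h : par h = None -> nb h = set0.
  rewrite /par; case: pickP => // nopick _; apply/eqP/negPn/negP => /set0Pn[a ah].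
  have [b bh bmax] := arg_maxnP tau ah; have := nopick b.
  by rewrite (bh : b \in nb h) /= => /negP[]; apply/forall_inP.
pose P (i j : option U) := if i is Some h then par h == j else false.
pose ht (i : option U) := if i is Some h then (tau h).+1 else 0.
have Pht i j : P i j -> ht j < ht i.
  by case: i j => // h [p|] //= /eqP/parS[/tauP]; rewrite ltnS.
have Pfun i j j' : P i j -> P i j' -> j = j'.
  by case: i => // h /eqP <- /eqP.
pose E := [rel i j | P i j || P j i].
have Esym : symmetric E by move=> i j; rewrite /= orbC.
pose B (i : option U) := if i is Some h then h |: nb h else set0.
exists (option U), E, B; split.
- split.
  + by split=> // i; apply/negP => /orP[] /Pht; rewrite ltnn.
  + by apply/card_gt0P; exists None.
  + have toN i : connect E i None.
      move En: (ht i) => m; elim/ltn_ind: m i En => m IH [h|] En //.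
      have Ph : P (Some h) (par h) by rewrite /P eqxx.
      apply: (@connect_trans _ _ (par h)); first by apply: connect1; rewrite /= eqxx.
      by apply: IH erefl; rewrite -En; apply: Pht.
    move=> i j; apply: (connect_trans (toN i)).
    by rewrite (sym_connect_sym Esym).
  + by move=> c0; apply: parent_acyclic Pht Pfun.
- by move=> v; exists (Some v); rewrite setU11.
- by move=> u v /enb/orP[uv|vu]; [exists (Some v)|exists (Some u)];
    rewrite /= setU11 ?andbT /= in_setU1 ?uv ?vu orbT.
- move=> v; set R := [rel a b | _].
  have Rsym : symmetric R by move=> i j; rewrite /R /= orbC [(v \in B i) && _]andbC.
  have tov i : v \in B i -> connect R i (Some v).
    move En: (ht i) => m; elim/ltn_ind: m i En => m IH [h|] En; last by rewrite inE.
    rewrite in_setU1 => /orP[/eqP->|vh]; first exact: connect0.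
    case Ep: (par h) => [p|]; last by rewrite (parN _ Ep) inE in vh.
    have [ph pmax] := parS _ _ Ep.
    have vp : v \in B (Some p).
      rewrite in_setU1; have [//|ne] := eqVneq v p.
      case/orP: (clP h v p vh ph ne) => [//|/tauP].
      by rewrite ltnNge pmax.
    apply: (@connect_trans _ _ (Some p)).
      by apply: connect1; rewrite /R /= Ep eqxx /= in_setU1 vh orbT.
    by apply: IH erefl vp; rewrite -En; apply: Pht; rewrite /P Ep.
  move=> i j vi vj; apply: (connect_trans (tov i vi)).
  by rewrite (sym_connect_sym Rsym); apply: tov.
- move=> [h|] /=; last by rewrite cards0.
  by rewrite cardsU1; have := nbc h; case: (h \notin _) => /=; lia.
Qed.

Lemma elim_order_scheme (T : finType) (e lt : rel T) k :
  elim_order e lt k -> elim_scheme (elim_set e lt) (rank lt) k.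
Proof.
move=> [lt_forest e_lt Ak]; split=> //.
  by move=> a h /elim_set_lt; apply: ltn_rank.
move=> h a b ah bh ne.
have /or3P[/eqP E|ab|ba] := lt_chain lt_forest (elim_set_lt ah) (elim_set_lt bh).
- by rewrite E eqxx in ne.
- by rewrite (elim_set_down lt_forest ah ab) // lt_up // (elim_set_lt bh).
- by rewrite (elim_set_down lt_forest bh ba) ?orbT // lt_up // (elim_set_lt ah).
Qed.

Lemma elim_order_tw_le (T : finType) (e lt : rel T) k :
  symmetric e -> elim_order e lt k -> tw_le e k.
Proof.
move=> e_sym eo; apply: elim_scheme_tw_le (elim_order_scheme eo) _.
have [lt_forest e_lt _] := eo; move=> u v euv; apply/orP.
case/orP: (e_lt _ _ euv) => lt_uv; [left|right]; apply/elim_setP; split=> //.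
  by exists v; rewrite ?up_refl.
by exists u; rewrite ?up_refl // e_sym.
Qed.

(** * Rooting a decomposition tree *)

Section TreeOrder.
Variables (I : finType) (E : rel I).
Hypothesis E_tree : is_tree E.

Lemma tree_sym : symmetric E. Proof. by case: E_tree => -[]. Qed.

Lemma tree_unique_edge (S : {set I}) b a a' :
  conn E S -> b \notin S -> a \in S -> a' \in S -> E a b -> E a' b -> a = a'.
Proof.
move=> cS bS aS a'S Eab Ea'b; apply/eqP/negPn/negP => ne.
have [p [pp pl pu pS]] := conn_path cS aS a'S.
have [_ _ _ acyc] := E_tree.
have : size (b :: a :: p) <= 2.
  apply: acyc; apply/andP; split.
    by rewrite /= rcons_path pp pl Ea'b tree_sym Eab.
  rewrite cons_uniq pu andbT inE negb_or; apply/andP; split.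
    by apply: contraNneq bS => ->.
  by apply: contra bS; apply: pS.
by case: p pl {pp pu pS} => //= E0; rewrite E0 eqxx in ne.
Qed.

(** The last clause makes the lower end [b] of an edge the parent of the upper end [a]. *)
Definition tree_order_on (S : {set I}) (lt : rel I) : Prop :=
  [/\ forest_order lt, (forall a b, lt a b -> (a \in S) && (b \in S)),
      (forall a b, a \in S -> b \in S -> E a b -> lt a b || lt b a) &
      (forall a b z, E a b -> lt b a -> lt z a -> (z == b) || lt z b)].

(** An edge from [a] in [S] to [b] outside attaches [b] as a leaf just above [a]; by acyclicity it
    is the only edge from [b] to [S]. *)
Lemma grow_tree_order (S : {set I}) lt : conn E S -> S != set0 -> S != setT ->
  tree_order_on S lt ->
  exists (S' : {set I}) lt', [/\ S \proper S', conn E S' & tree_order_on S' lt'].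
Proof.
move=> cS /set0Pn[x xS]; rewrite -subTset => /subsetPn[y _ yS].
case=> lt_forest ltS Elt cov; have [_ _ Econ _] := E_tree.
have [a [b [aS bS Eab]]] := connect_exit (Econ x y) xS yS.
have neq z : z \in S -> (z == b) = false by move=> zS; apply: contraNF bS => /eqP<-.
have ltb z : lt b z = false by apply: contraNF bS => /ltS/andP[].
pose lt' := [rel x y | if y == b then (x == a) || lt x a else lt x y].
have lt_irr := lt_irr lt_forest; have lt_tr := lt_tr lt_forest.
have lt'b z : lt' b z = false.
  by rewrite /lt' /=; case: ifP => _; rewrite ltb // orbF eq_sym neq.
exists (b |: S), lt'; split.
- by apply/properP; split; [apply: subsetUr|exists b; rewrite ?setU11].
- have cb z : z \in S -> connect (restr E (b |: S)) z b.
    move=> zS; apply: (connect_trans (y := a)); last first.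
      by apply: connect1; rewrite /restr /= setU11 in_setU1 aS orbT.
    have : connect (restr E S) z a by move/connP: cS; apply.
    apply: connect_sub => u v /and3P[uS vS Euv]; apply: connect1.
    by rewrite /restr /= !in_setU1 uS vS !orbT.
  have symR : connect_sym (restr E (b |: S)) by apply/sym_connect_sym/restr_sym/tree_sym.
  have cb' z : z \in b |: S -> connect (restr E (b |: S)) z b.
    by rewrite in_setU1 => /orP[/eqP->|/cb].
  apply/connP => u v uS vS; apply: (connect_trans (cb' u uS)).
  by rewrite symR; apply: cb'.
- split.
  + split.
    * move=> z; rewrite /lt' /=; case: eqP => [->|_]; last exact: lt_irr.
      by rewrite ltb orbF eq_sym neq.
    * move=> v u w; rewrite /lt' /=; have [->|vb] := eqVneq v b.
        by move=> _; case: ifP => _; rewrite ltb // orbF eq_sym neq.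
      move=> uv; case: ifP => _; last exact: lt_tr uv.
      by case/orP=> [/eqP va|/(lt_tr _ _ _ uv)->]; rewrite -?va ?uv orbT.
    * move=> u v w; rewrite /lt' /=; case: ifP => _ uw vw; last first.
        have [/ltS/andP[uS _] /ltS/andP[vS _]] := (uw, vw).
        by rewrite !neq //; apply: lt_chain uw vw.
      have uS : u \in S by case/orP: uw => [/eqP->|/ltS/andP[]].
      have vS : v \in S by case/orP: vw => [/eqP->|/ltS/andP[]].
      rewrite !neq //; case/orP: uw => [/eqP->|ua]; case/orP: vw => [/eqP->|va].
      - by rewrite eqxx. - by rewrite va !orbT. - by rewrite ua !orbT.
      - exact: lt_chain ua va.
  + move=> u v; rewrite /lt' /= !in_setU1; case: ifP => _ /=.
      by case/orP=> [/eqP->|/ltS/andP[-> _]]; rewrite ?aS orbT.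
    by case/ltS/andP=> -> ->; rewrite !orbT.
  + have Eb u : u \in S -> E u b -> u = a by move=> uS Eub; exact: (tree_unique_edge cS bS uS aS Eub Eab).
    move=> u v; rewrite /lt' /= !in_setU1 => /orP[/eqP->|uS] /orP[/eqP->|vS].
    * by have [[_ irr] _ _ _] := E_tree; rewrite irr.
    * by rewrite tree_sym => /(Eb v vS)->; rewrite !eqxx orbT.
    * by move=> /(Eb u uS)->; rewrite !eqxx.
    * by rewrite !neq //; apply: Elt.
  + move=> u v z; have [->|ub] := eqVneq u b; last first.
      rewrite /lt' /= (negPf ub) => Euv vu zu; have vS : v \in S by case/andP: (ltS _ _ vu).
      by rewrite neq //; apply: cov Euv vu zu.
    rewrite /lt' /= eqxx => Ebv va; have vS : v \in S by case/orP: va => [/eqP->|/ltS/andP[]].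
    have -> : v = a by apply: tree_unique_edge cS bS vS aS _ Eab; rewrite tree_sym.
    by rewrite neq.
Qed.

Lemma tree_order : exists lt : rel I,
  [/\ forest_order lt, (forall a b, E a b -> lt a b || lt b a) &
      (forall a b z, E a b -> lt b a -> lt z a -> (z == b) || lt z b)].
Proof.
suff [lt [lt_forest _ Elt cov]] : exists lt, tree_order_on setT lt.
  by exists lt; split=> // a b; apply: Elt; rewrite inE.
have : exists (S : {set I}) lt, [/\ conn E S, S != set0 & tree_order_on S lt].
  have [_ /card_gt0P[i0 _] _ _] := E_tree.
  exists [set i0], (fun _ _ => false); split.
  - by apply/connP => a b /set1P-> /set1P->; apply: connect0.
  - by apply/set0Pn; exists i0; rewrite set11.
  - split=> //.
    by have [[_ irr] _ _ _] := E_tree; move=> a b /set1P-> /set1P->; rewrite irr.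
case=> S; move En: #|~: S| => m; elim/ltn_ind: m S En => m IH S En [lt [cS Sn oS]].
have [ST|ST] := eqVneq S setT; first by exists lt; rewrite -ST.
have [S' [lt' [SS' cS' oS']]] := grow_tree_order cS Sn ST oS.
apply: (IH #|~: S'| _ S') => //; first by rewrite -En; apply: proper_card; rewrite properC ?setCK.
exists lt'; split=> //; apply: contra_neq Sn => S'0.
by apply/eqP; rewrite -subset0 -S'0 proper_sub.
Qed.
End TreeOrder.

(** Vertices are ordered by the root [top v] of the subtree of bags containing them, ties being
    broken by enumeration. Then [elim_set v] is contained in the bag at [top v] without [v]. *)
Lemma tw_le_elim_order (T : finType) (e : rel T) k :
  simple_graph e -> tw_le e k -> exists lt, elim_order e lt k.
Proof.
move=> [e_sym e_irr] [I [E [B [E_tree Bcov Bedge Bconn Bk]]]].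
have [ltI [I_forest I_cmp I_cov]] := tree_order E_tree.
have E_sym := tree_sym E_tree.
pose S v := [set i | v \in B i].
have cS v : conn E (S v).
  apply/connP => i j; rewrite !inE => vi vj; have := Bconn v i j vi vj.
  by apply: connect_sub => a b /and3P[Eab va vb]; apply: connect1; rewrite /restr /= !inE va vb.
have topP v : exists i, (i \in S v) && (S v \subset upset ltI i).
  have [i vi] := Bcov v; have Sn : S v != set0 by apply/set0Pn; exists i; rewrite inE.
  by have [r rS Sr] := conn_min E_sym I_forest I_cmp (cS v) Sn; exists r; rewrite rS.
have [top topE] := fin_all_exists topP.
have topS v : top v \in S v by case/andP: (topE v).
have topU v i : i \in S v -> i \in upset ltI (top v) by case/andP: (topE v) => _ /subsetP; apply.
pose lt : rel T :=
  fun u v => ltI (top u) (top v) || (top u == top v) && (enum_rank u < enum_rank v).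
have up_top u v : v \in upset lt u -> top v \in upset ltI (top u).
  rewrite !inE => /orP[/eqP->|/orP[->|/andP[/eqP-> _]]]; rewrite ?eqxx ?orbT //.
have ltIirr := lt_irr I_forest; have ltItr := lt_tr I_forest.
have lt_forest : forest_order lt.
  split.
  - by move=> u; rewrite /lt ltIirr ltnn andbF.
  - move=> v u w; rewrite /lt; move=> /orP[uv|/andP[/eqP uv r]] /orP[vw|/andP[/eqP vw r']].
    + by rewrite (ltItr _ _ _ uv vw). + by rewrite -vw uv. + by rewrite uv vw.
    + by rewrite uv vw eqxx (ltn_trans r r') orbT.
  - have same u v : top u = top v -> [|| u == v, lt u v | lt v u].
      move=> uv; rewrite /lt /= uv eqxx ltIirr /=.
      case: (ltngtP (enum_rank u) (enum_rank v)); rewrite ?orbT //.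
      by move=> /val_inj/enum_rank_inj->; rewrite eqxx.
    have ltT u v : ltI (top u) (top v) -> lt u v by rewrite /lt /= => ->.
    move=> u v w /(lt_up (lt := lt))/up_top uw /(lt_up (lt := lt))/up_top vw.
    case/orP: (up_chain I_forest uw vw); rewrite in_up => /orP[/eqP|/ltT->]; rewrite ?orbT //.
      by move/same.
    by move/esym/same.
exists lt; split=> //.
- move=> u v euv; have [i /andP[ui vi]] := Bedge _ _ euv.
  have uv : u != v by apply: contraTneq euv => ->; rewrite e_irr.
  have uS : i \in S u by rewrite inE. have vS : i \in S v by rewrite inE.
  have cmp : (top u == top v) || (ltI (top u) (top v) || ltI (top v) (top u)).
    case/orP: (up_chain I_forest (topU u i uS) (topU v i vS)); rewrite in_up => /orP[/eqP->|->];
    by rewrite ?eqxx ?orbT.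
  rewrite /lt /=; case/or3P: cmp => [/eqP->|->|->]; rewrite ?orbT //.
  rewrite ltIirr eqxx /=; case: (ltngtP (enum_rank u) (enum_rank v)) => //.
  by move=> /val_inj/enum_rank_inj uvE; rewrite uvE eqxx in uv.
- move=> v; rewrite -ltnS; apply: leq_trans (Bk (top v)).
  rewrite (cardsD1 v (B (top v))); have := topS v; rewrite inE => -> /=.
  rewrite add1n ltnS; apply: subset_leq_card; apply/subsetP => u /elim_setP[uv [w wv euw]].
  have unv : u != v by apply: contraTneq uv => ->; rewrite (lt_irr lt_forest).
  rewrite !inE unv /=; have [i /andP[ui wi]] := Bedge _ _ euw.
  have uS : i \in S u by rewrite inE. have wS : i \in S w by rewrite inE.
  have iv : i \in upset ltI (top v) := up_trans I_forest (up_top _ _ wv) (topU w i wS).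
  have [<-|ne] := eqVneq (top u) (top v); first by have := topS u; rewrite inE.
  have luv : ltI (top u) (top v) by move: uv; rewrite /lt /= (negPf ne) orbF.
  (* The subtree of [u] contains [top u] below [top v] and [i] above it. The edge by which it leaves
     the up-set of [top v] must start at [top v], so [u] is in that bag. *)
  have [a [b [aS bS av bv Eab]]] := conn_exit (cS u) uS (topS u) iv (lt_nup I_forest luv).
  have [<-|nva] := eqVneq a (top v); first by rewrite inE in aS.
  case/orP: (I_cmp _ _ Eab) => [ab|ba].
    by case/negP: bv; apply: (up_trans I_forest av); apply: lt_up.
  have va : ltI (top v) a by apply: up_neq_lt; rewrite // eq_sym.
  by case/negP: bv; rewrite in_up; apply: I_cov Eab ba va.
Qed.

Theorem disjointed_tpw_le (T : finType) (e : rel T) c n k :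
  simple_graph e -> tw_le e k -> disjointed e c n ->
  tpw_le c e (2 * (n.+1 * (2 * k.+1) ^ c).+1 * k.+1).
Proof.
move=> e_simple tw e_disj; have [e_sym e_irr] := e_simple.
have [lt eo] := tw_le_elim_order e_simple tw.
have [nb [tau [part [sch edge fib]]]] := bounded_elim_partition e_sym eo e_disj.
exists T, [rel a b | (a \in nb b) || (b \in nb a)], part; split=> //.
- split=> [a b|a] /=; first by rewrite orbC.
  by apply/negP => /orP[] aa; have [/(_ _ _ aa)] := sch; rewrite ltnn.
- exact: elim_scheme_tw_le sch _.
- move=> u v euv; case/or4P: (edge u v euv) => [/eqP uv|/eqP|uv|vu]; first by left; rewrite uv.
  + by left.
  + by right; rewrite /= uv.
  + by right; rewrite /= vu orbT.
Qed.

(** * Subdivisions of complete graphs *)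

Section Subdivisions.
Variables (T : finType) (e : rel T).
Hypothesis e_sym : symmetric e.

Lemma link_through (S : {set T}) x y : conn e S -> adj e S x -> adj e S y ->
  exists p, [/\ path e x (rcons p y), uniq p & {subset p <= S}].
Proof.
move=> cS /exists_inP[a aS ax] /exists_inP[b bS eby].
have [p [pp pl pu pS]] := conn_path cS aS bS.
exists (a :: p); split=> //; first by rewrite /= e_sym ax rcons_path pp pl.
by move=> z; rewrite inE => /orP[/eqP->|/pS].
Qed.

Lemma Kt_free_disjointed t : Kt_topminor_free t e -> disjointed e t (t * t).
Proof.
move=> free X v F cX v_inj vX FP Fd; apply: free.
pose idx (i j : 'I_t) := i * t + j.
have idx_lt i j : idx i j < t * t.
  have := ltn_ord i; have := ltn_ord j; rewrite /idx; nia.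
have idx_inj i j i' j' : idx i j = idx i' j' -> (i, j) = (i', j').
  move=> E; have Ej : j = j' :> nat.
    by have := congr1 (modn^~ t) E; rewrite /idx !modnMDl !modn_small.
  have Ei : i = i' :> nat.
    have t0 : 0 < t by apply: leq_ltn_trans (ltn_ord i).
    by have := congr1 (divn^~ t) E; rewrite /idx !divnMDl // !divn_small // !addn0.
  by rewrite (val_inj Ei) (val_inj Ej).
have exP i : exists g : 'I_t -> seq T, forall j, [/\ path e (v i) (rcons (g j) (v j)), uniq (g j) &
    {subset g j <= F (idx i j)}].
  have exj j : exists p, [/\ path e (v i) (rcons p (v j)), uniq p & {subset p <= F (idx i j)}].
    by have [_ _ cF aF] := FP _ (idx_lt i j); apply: link_through.
  by have [g gP] := fin_all_exists exj; exists g.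
have [P PP] := fin_all_exists exP.
have PX i j z : z \in P i j -> z \in X.
  have [_ _ PF] := PP i j; have [FX _ _ _] := FP _ (idx_lt i j).
  by move/PF/(subsetP FX).
exists v, P; split=> //.
- move=> i j ij; have [pp pu PF] := PP i j; rewrite pp /=.
  rewrite mem_rcons inE negb_or rcons_uniq pu andbT (inj_eq v_inj).
  have vP l : v l \notin P i j by apply/negP => /PX; rewrite (negPf (vX l)).
  by rewrite !vP !andbT; apply: contraTneq ij => ->; rewrite ltnn.
- by move=> i j z ij /PX zX l; apply: contraTneq zX => ->.
- move=> i j i' j' z _ _ ne zP; apply/negP => zP'.
  have [_ _ /(_ z zP) zF] := PP i j; have [_ _ /(_ z zP') zF'] := PP i' j'.
  have : idx i j != idx i' j' by apply: contraNneq ne => /idx_inj->.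
  rewrite neq_ltn => /orP[lt_ij|lt_ij].
    by have := disjointFr (Fd _ _ (introT andP (conj lt_ij (idx_lt i' j')))) zF; rewrite zF'.
  by have := disjointFr (Fd _ _ (introT andP (conj lt_ij (idx_lt i j)))) zF'; rewrite zF.
Qed.

(* The pairs [i < j] are listed in the order 01, 02, 12, 03, 13, 23, ... *)
Lemma subdivision_of_uniq t (x0 : T) (b : t.-tuple T) (ps : seq (seq T)) :
  uniq (b ++ flatten ps) ->
  (forall i j, i < j < t ->
    path e (nth x0 b i) (rcons (nth [::] ps (i + 'C(j, 2))) (nth x0 b j))) ->
  has_Kt_subdivision t e.
Proof.
rewrite cat_uniq => /and3P[ub /hasPn bps ups] pathP.
pose idx (i j : nat) := i + 'C(j, 2).
(* The pairs with larger member [j] occupy the [j] positions from ['C(j, 2)] up to ['C(j.+1, 2)],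
   exclusive. *)
have idx_lt i j i' j' : i < j -> j < j' -> idx i j < idx i' j'.
  move=> ij jj'; have : 'C(j.+1, 2) <= 'C(j', 2) by apply: leq_bin2l.
  by rewrite binS bin1 /idx; lia.
have idx_inj (i j i' j' : 'I_t) : i < j -> i' < j' -> idx i j = idx i' j' -> (i, j) = (i', j').
  move=> ij ij'; case: (ltngtP j j') => [jj'|jj'|/val_inj jj'] E.
  - by have := idx_lt i j i' j' ij jj'; rewrite E ltnn.
  - by have := idx_lt i' j' i j ij' jj'; rewrite E ltnn.
  - by move: E; rewrite jj' /idx => /addIn/val_inj->.
have mem_nth_flatten k x : x \in nth [::] ps k -> x \in flatten ps.
  move=> xk; apply/flattenP; exists (nth [::] ps k) => //; apply: mem_nth.
  by rewrite ltnNge; apply/negP => /(nth_default [::]) E; rewrite E in xk.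
have nth_flatten_disj k l x : k != l -> x \in nth [::] ps k -> x \notin nth [::] ps l.
  elim: ps ups k l {bps pathP mem_nth_flatten} => [|p ps IH] /=; first by move=> _ k l; rewrite nth_nil.
  rewrite cat_uniq => /and3P[_ /hasPn dis ups'] [|k] [|l] //=.
  - move=> _ xp; apply/negP => xl; have/dis/negP[] // : x \in flatten ps.
    apply/flattenP; exists (nth [::] ps l) => //; apply: mem_nth.
    by rewrite ltnNge; apply/negP => /(nth_default [::]) E; rewrite E in xl.
  - move=> _ xk; apply: dis; apply/flattenP; exists (nth [::] ps k) => //; apply: mem_nth.
    by rewrite ltnNge; apply/negP => /(nth_default [::]) E; rewrite E in xk.
  - by rewrite eqSS; apply: IH.
have nth_uniq_flatten k : uniq (nth [::] ps k).
  elim: ps ups k {bps pathP mem_nth_flatten nth_flatten_disj} => [|p ps IH] /=; first by move=> _ k; rewrite nth_nil.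
  by rewrite cat_uniq => /and3P[up _ ups'] [|k] //=; apply: IH.
have nb i x : x \in flatten ps -> x != tnth b i.
  by move=> /bps xb; apply: contraNneq xb => ->; apply: mem_tnth.
exists (tnth b), (fun i j => nth [::] ps (idx i j)); split.
- by apply/injectiveP; rewrite /injectiveb /dinjectiveb map_tnth_enum.
- move=> i j ij; have := pathP i j; rewrite ij ltn_ord => /(_ isT).
  rewrite -!tnth_nth => -> /=.
  rewrite mem_rcons inE negb_or rcons_uniq nth_uniq_flatten andbT.
  have nin l : tnth b l \notin nth [::] ps (idx i j).
    by apply/negP => /mem_nth_flatten/(nb l); rewrite eqxx.
  rewrite !nin !andbT (tnth_nth x0) (tnth_nth x0 b j) nth_uniq ?size_tuple //.
  by rewrite neq_ltn ij.
- by move=> i j x ij /mem_nth_flatten xf l; apply: nb.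
- by move=> i j i' j' x ij ij' ne; apply: nth_flatten_disj; apply: contraNneq ne => /idx_inj->.
Qed.

Lemma last_visit (P : {pred T}) x s : x \in P ->
  exists s1 s2, [/\ s = s1 ++ s2, last x s1 \in P & forall y, y \in s2 -> y \notin P].
Proof.
move=> xP; elim/last_ind: s => [|s y [s1 [s2 [-> lP s2P]]]]; first by exists [::], [::].
have [yP|yP] := boolP (y \in P).
  by exists (rcons (s1 ++ s2) y), [::]; rewrite cats0 last_rcons.
exists s1, (rcons s2 y); rewrite rcons_cat; split=> // z.
by rewrite mem_rcons inE => /orP[/eqP->|/s2P].
Qed.

(** The centre [m] is the last vertex of a path from [x1] to [x3] that lies on a path from [x1] to
    [x2]. *)
Lemma tripod (S : {set T}) x1 x2 x3 : conn e S -> x1 \in S -> x2 \in S -> x3 \in S ->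
  exists m p1 p2 p3,
    [/\ path e m p1 /\ last m p1 = x1, path e m p2 /\ last m p2 = x2,
        path e m p3 /\ last m p3 = x3, uniq (m :: p1 ++ p2 ++ p3) &
        {subset m :: p1 ++ p2 ++ p3 <= S}].
Proof.
move=> cS S1 S2 S3.
have [q [qp ql qu qS]] := conn_path cS S1 S2.
have [s [sp sl su sS]] := conn_path cS S1 S3.
have [s1 [s2 [sE mP s2P]]] := @last_visit [in x1 :: q] x1 s (mem_head _ _).
move: sp sl; rewrite sE cat_path last_cat => /andP[_ s2p] s2l.
set m := last x1 s1 in mP s2p s2l.
case/splitPl: mP ql qp qu qS s2P => q1 q2 mE; rewrite cat_path last_cat mE.
move=> q2l /andP[q1p q2p] qu qS s2P.
have permq : perm_eq (m :: rev (belast x1 q1) ++ q2 ++ s2) ((x1 :: q1 ++ q2) ++ s2).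
  apply/permP => z; rewrite /= !count_cat count_rev.
  have := congr1 (count z) (lastI x1 q1); rewrite mE -cats1 count_cat /=; lia.
exists m, (rev (belast x1 q1)), q2, s2; split=> //.
- split; last by case: (q1) mE => [|y q1'] /= mE; rewrite ?rev_cons ?last_rcons.
  by rewrite -mE rev_path; apply: sub_path q1p => a b; rewrite e_sym.
- rewrite (perm_uniq permq) cat_uniq qu; apply/and3P; split=> //; last first.
    by move: su; rewrite sE /= cat_uniq => /andP[_ /and3P[]].
  by apply/hasPn => z /s2P.
- move=> z; rewrite (perm_mem permq) mem_cat inE => /orP[/orP[/eqP->//|/qS//]|zs2].
  by apply: sS; rewrite sE mem_cat zs2 orbT.
Qed.

(** The branch vertices are [v1], [v2] and the centres of two tripods: the one in [A] leads to [v1],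
    [v2] and [a], the one in [B] to [v1], [v2] and [b]. The edge [ab] links the centres, and [C]
    links [v1] to [v2]. *)
Lemma K4_of_connected_sets (A B C : {set T}) v1 v2 a b :
  [/\ conn e A, conn e B & conn e C] ->
  [/\ [disjoint A & B], [disjoint A & C] & [disjoint B & C]] ->
  v1 != v2 -> v1 \notin A :|: B :|: C -> v2 \notin A :|: B :|: C ->
  [/\ adj e A v1, adj e B v1 & adj e C v1] ->
  [/\ adj e A v2, adj e B v2 & adj e C v2] ->
  a \in A -> b \in B -> e a b -> has_Kt_subdivision 4 e.
Proof.
move=> [cA cB cC] [dAB dAC dBC] v12 nv1 nv2 [A1 B1 C1] [A2 B2 C2] aA bB eab.
case/exists_inP: A1 => a1 a1A ea1; case/exists_inP: A2 => a2 a2A ea2.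
case/exists_inP: B1 => b1 b1B eb1; case/exists_inP: B2 => b2 b2B eb2.
have [mA [pa1 [pa2 [pa [[pa1p pa1l] [pa2p pa2l] [pap pal] uA subA]]]]] := tripod cA a1A a2A aA.
have [mB [pb1 [pb2 [pb [[pb1p pb1l] [pb2p pb2l] [pbp pbl] uB subB]]]]] := tripod cB b1B b2B bB.
have [pc [pcp uC subC]] := link_through cC C1 C2.
pose ps := [:: pa ++ rev pb; pa1; pb1; pa2; pb2; pc].
have perm_all : perm_eq ([:: mA; mB; v1; v2] ++ flatten ps)
    ((mA :: pa1 ++ pa2 ++ pa) ++ (mB :: pb1 ++ pb2 ++ pb) ++ pc ++ [:: v1; v2]).
  apply/permP => z; rewrite /ps /= cats0 !count_cat /= !count_cat /= count_rev.
  by clear; lia.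
apply: (@subdivision_of_uniq 4 mA [tuple mA; mB; v1; v2] ps).
  rewrite (perm_uniq perm_all) cat_uniq uA; apply/and3P; split=> //.
    apply/hasPn => z; rewrite !mem_cat => zz; apply/negP => /subA zA.
    case/or3P: zz => [/subB zB|/subC zC|].
    - by have := disjointFr dAB zA; rewrite zB.
    - by have := disjointFr dAC zA; rewrite zC.
    - by rewrite !inE => /orP[]/eqP E; [case/negP: nv1|case/negP: nv2]; rewrite -E !inE zA.
  rewrite cat_uniq uB; apply/and3P; split=> //.
    apply/hasPn => z; rewrite !mem_cat => zz; apply/negP => /subB zB.
    case/orP: zz => [/subC zC|].
    - by have := disjointFr dBC zB; rewrite zC.
    - by rewrite !inE => /orP[]/eqP E; [case/negP: nv1|case/negP: nv2]; rewrite -E !inE zB orbT.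
  rewrite cat_uniq uC /= inE v12 /= !andbT.
  by rewrite orbF negb_or; apply/andP; split; apply/negP => /subC vC;
    [case/negP: nv1|case/negP: nv2]; rewrite !inE vC orbT.
have rp x p y z : path e x p -> last x p = y -> e y z -> path e x (rcons p z).
  by rewrite rcons_path => -> ->.
case=> [|[|[|[|i]]]] [|[|[|[|j]]]] //=; rewrite ?andbF //= => _.
- rewrite rcons_cat cat_path pap pal -rev_cons lastI pbl rev_rcons /= eab -pbl rev_path.
  by apply: sub_path pbp => x y; rewrite e_sym.
- exact: rp pa1p pa1l ea1.
- exact: rp pa2p pa2l ea2.
- exact: rp pb1p pb1l eb1.
- exact: rp pb2p pb2l eb2.
Qed.

(** [F 0] is enlarged to a component [A] of [X] without [F 1] and [F 2]. Since [X] is connected, an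
    edge leaves [A] inside [X], and it ends in [F 1] or [F 2]; the other of the two links the outer
    vertices. *)
Lemma K4_free_disjointed : Kt_topminor_free 4 e -> disjointed e 2 3.
Proof.
move=> free X v F cX v_inj vX FP Fd; apply: free.
have [F0X /set0Pn[a0 a0F] cF0 aF0] := FP 0 isT.
have [F1X /set0Pn[a1 a1F] cF1 aF1] := FP 1 isT.
have [F2X _ cF2 aF2] := FP 2 isT.
have d01 : [disjoint F 0 & F 1] by apply: Fd. have d02 : [disjoint F 0 & F 2] by apply: Fd.
have d12 : [disjoint F 1 & F 2] by apply: Fd.
pose R := X :\: (F 1 :|: F 2).
have F0R : F 0 \subset R.
  rewrite subsetD F0X /= disjoint_sym disjoints_subset subUset -!disjoints_subset.
  by rewrite ![[disjoint _ & F 0]]disjoint_sym d01.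
have a0R := subsetP F0R a0 a0F.
pose A := comp e R a0; have AR : A \subset R by apply: comp_sub.
have F0A : F 0 \subset A by apply: conn_sub_comp.
have cA : conn e A by apply: comp_conn.
have dA1 : [disjoint A & F 1].
  apply: disjointWl AR _; rewrite disjoints_subset; apply/subsetP => x.
  by rewrite !inE negb_or => /andP[/andP[]].
have dA2 : [disjoint A & F 2].
  apply: disjointWl AR _; rewrite disjoints_subset; apply/subsetP => x.
  by rewrite !inE negb_or => /andP[/andP[]].
have AX : A \subset X by apply: subset_trans AR (subsetDl _ _).
have a1A : a1 \notin A by apply/negP => a1A; have := disjointFr dA1 a1A; rewrite a1F.
have a0X := subsetP F0X a0 a0F; have a1X := subsetP F1X a1 a1F.
have [a [b [aX bX aA bA eab]]] := conn_exit cX a0X a1X (comp_self e R a0) a1A.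
have adjA l : adj e A (v l).
  by have /exists_inP[u uF eu] := aF0 l; apply/exists_inP; exists u; rewrite ?(subsetP F0A).
have v12 : v ord0 != v ord_max by rewrite (inj_eq v_inj).
have nv (S : {set T}) l : S \subset X -> v l \notin S.
  by move=> SX; apply: contra (vX l) => /(subsetP SX).
have bF : b \in F 1 :|: F 2.
  by apply: contraR bA => bF; apply: (comp_closed a0R aA _ eab); rewrite inE bF.
have U1 : A :|: F 1 :|: F 2 \subset X by rewrite !subUset AX F1X.
have U2 : A :|: F 2 :|: F 1 \subset X by rewrite !subUset AX F1X F2X.
case/setUP: bF => bF.
  by apply: (@K4_of_connected_sets A (F 1) (F 2) (v ord0) (v ord_max) a b) => //; apply: nv.
apply: (@K4_of_connected_sets A (F 2) (F 1) (v ord0) (v ord_max) a b) => //; try exact: nv.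
by split=> //; rewrite disjoint_sym.
Qed.

(** Two neighbours of [v ord0] in disjoint subsets of [X] are joined by a path in [X], which closes
    to a cycle. *)
Lemma K3_free_disjointed : Kt_topminor_free 3 e -> disjointed e 1 2.
Proof.
move=> free X v F cX _ vX FP Fd; apply: free.
have [F0X _ _ /(_ ord0)/exists_inP[a aF eav]] := FP 0 isT.
have [F1X _ _ /(_ ord0)/exists_inP[b bF ebv]] := FP 1 isT.
have [aX bX] := (subsetP F0X a aF, subsetP F1X b bF).
have ab : b != a.
  have d01 : [disjoint F 0 & F 1] by apply: Fd.
  by apply/eqP => E; have := disjointFr d01 aF; rewrite -E bF.
have [p [pp pl pu pX]] := conn_path cX aX bX.
case: (lastP p) pp pl pu pX => [_ /= E|q z]; first by rewrite E eqxx in ab.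
rewrite last_rcons => pp zb; rewrite {z}zb in pp *; rewrite -rcons_cons rcons_uniq => /andP[bq uq] qX.
apply: (@subdivision_of_uniq 3 a [tuple v ord0; a; b] [:: [::]; [::]; q]); last first.
  by case=> [|[|[|i]]] [|[|[|j]]] //=; rewrite ?andbF //= => _; rewrite e_sym ?eav ?ebv.
have nv x : x \in X -> v ord0 != x by apply: contraTneq => <-.
rewrite /= cats0 !inE !negb_or !nv //= eq_sym ab /=.
move: bq uq; rewrite inE negb_or /= => /andP[_ ->] /andP[-> ->]; rewrite /= andbT.
by apply/negP => vq; case/negP: (vX ord0); apply: qX; rewrite mem_rcons inE vq orbT.
Qed.

Lemma K2_free_disjointed : Kt_topminor_free 2 e -> disjointed e 0 2.
Proof.
move=> free X v F cX _ vX FP Fd; apply: free.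
have [F0X /set0Pn[a aF] _ _] := FP 0 isT; have [F1X /set0Pn[b bF] _ _] := FP 1 isT.
have bF0 : b \notin F 0.
  have d01 : [disjoint F 0 & F 1] by apply: Fd.
  by apply/negP => bF0; have := disjointFr d01 bF0; rewrite bF.
have [x [y [_ _ xF yF exy]]] := conn_exit cX (subsetP F0X a aF) (subsetP F1X b bF) aF bF0.
apply: (@subdivision_of_uniq 2 a [tuple x; y] [:: [::]]); last first.
  by case=> [|[|i]] [|[|j]] //=; rewrite ?andbF //= => _; rewrite exy.
by rewrite /= inE !andbT; apply: contraNneq yF => <-.
Qed.

End Subdivisions.

(** * The lower bound *)

Lemma path_enter (T : finType) (e : rel T) (S : {pred T}) x p :
  path e x p -> x \notin S -> last x p \in S ->
  exists u v, [/\ u \in belast x p, u \notin S, v \in S & e u v].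
Proof.
elim: p x => [|y p IH] x /=; first by move=> _ /negP.
case/andP=> exy py xS lS; have [yS|yS] := boolP (y \in S).
  by exists x, y; rewrite mem_head.
have [u [v [ub uS vS euv]]] := IH y py yS lS.
by exists u, v; rewrite inE ub orbT.
Qed.

Lemma path_leave (T : finType) (e : rel T) (S : {pred T}) x p :
  path e x p -> x \in S -> last x p \notin S ->
  exists u v, [/\ u \in S, v \in p, v \notin S & e u v].
Proof.
elim: p x => [|y p IH] x /=; first by move=> _ ->.
case/andP=> exy py xS lS; have [yS|yS] := boolP (y \in S); last first.
  by exists x, y; rewrite mem_head.
have [u [v [uS vp vS euv]]] := IH y py yS lS.
by exists u, v; rewrite inE vp orbT.
Qed.

(* The [t - 1] paths of the subdivision leaving [b i] are disjoint and each of
   them crosses the boundary of [S]. *)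
Lemma Kt_boundary (T : finType) (e : rel T) t (b : 'I_t -> T) P (S : {set T}) i :
  symmetric e -> injective b ->
  (forall i j : 'I_t, i < j -> path e (b i) (rcons (P i j) (b j)) &&
     uniq (b i :: rcons (P i j) (b j))) ->
  (forall (i j : 'I_t) (v : T), i < j -> v \in P i j -> forall l : 'I_t, v != b l) ->
  (forall (i j i' j' : 'I_t) (v : T), i < j -> i' < j' ->
     (i, j) != (i', j') -> v \in P i j -> v \notin P i' j') ->
  b i \in S -> (forall j, j != i -> b j \notin S) -> t.-1 <= #|bdry e S|.
Proof.
move=> e_sym b_inj Pp Pb Pd iS nS.
have ex j : exists w, j != i ->
    (w \in bdry e S) && [|| w == b j, (i < j) && (w \in P i j) | (j < i) && (w \in P j i)].
  have [->|ji] := eqVneq j i; first by exists (b i).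
  case: (ltngtP i j) => [lt_ij|lt_ji|/val_inj E]; last by rewrite E eqxx in ji.
    have /andP[pp _] := Pp i j lt_ij.
    have lS : last (b i) (rcons (P i j) (b j)) \notin S by rewrite last_rcons nS.
    have [u [w [uS wp wS euw]]] := path_leave pp iS lS.
    exists w => _; apply/andP; split; first by apply/bdryP; split=> //; exists u.
    by move: wp; rewrite mem_rcons inE => /orP[->//|->]; rewrite orbT.
  have /andP[pp _] := Pp j i lt_ji.
  have lS : last (b j) (rcons (P j i) (b i)) \in S by rewrite last_rcons.
  have [w [u [wp wS uS euw]]] := path_enter pp (nS j ji) lS.
  exists w => _; apply/andP; split; first by apply/bdryP; split=> //; exists u; rewrite // e_sym.
  by move: wp; rewrite belast_rcons inE => /orP[->//|->]; rewrite !orbT.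
have [f fP] := fin_all_exists ex.
have f_inj : {in [set~ i] &, injective f}.
  move=> j l; rewrite !inE => ji li E; apply/eqP/negPn/negP => jl.
  have /andP[_ fj] := fP j ji; have /andP[_ fl] := fP l li; rewrite -E in fl.
  case/or3P: fj => [/eqP Ej|/andP[ij wj]|/andP[ij wj]]; case/or3P: fl => [/eqP El|/andP[il wl]|/andP[il wl]].
  - by case/negP: jl; apply/eqP; apply: b_inj; rewrite -Ej El.
  - by have := Pb _ _ _ il wl j; rewrite Ej eqxx.
  - by have := Pb _ _ _ il wl j; rewrite Ej eqxx.
  - by have := Pb _ _ _ ij wj l; rewrite El eqxx.
  - have ne : (i, j) != (i, l) by rewrite xpair_eqE eqxx.
    by have := Pd i j i l _ ij il ne wj; rewrite wl.
  - have ne : (i, j) != (l, i) by rewrite xpair_eqE eq_sym (negPf li).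
    by have := Pd i j l i _ ij il ne wj; rewrite wl.
  - by have := Pb _ _ _ ij wj l; rewrite El eqxx.
  - have ne : (j, i) != (i, l) by rewrite xpair_eqE (negPf ji).
    by have := Pd j i i l _ ij il ne wj; rewrite wl.
  - have ne : (j, i) != (l, i) by rewrite xpair_eqE (negPf jl).
    by have := Pd j i l i _ ij il ne wj; rewrite wl.
have <- : #|f @: [set~ i]| = t.-1 by rewrite card_in_imset // cardsC1 card_ord.
apply: subset_leq_card; apply/subsetP => w /imsetP[j]; rewrite !inE => ji ->.
by have /andP[] := fP j ji; rewrite inE.
Qed.

(** At a branch vertex of greatest rank, [Kt_boundary] is applied either to its up-set, whose
    boundary lies in its elimination set, or to the vertex alone. *)
Lemma elim_order_Kt_free (T : finType) (e lt : rel T) k t :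
  symmetric e -> 0 < t -> elim_order e lt k ->
  (forall v, (#|elim_set e lt v| < t.-1) || (#|[set u | e v u]| < t.-1)) ->
  Kt_topminor_free t e.
Proof.
move=> e_sym t0 [lt_forest e_lt _] small [b [P [b_inj Pp Pb Pd]]].
have [i _ imax] := @arg_maxnP _ (Ordinal t0) xpredT (fun i => rank lt (b i)) isT.
case/orP: (small (b i)); apply/negP; rewrite -leqNgt.
  apply: leq_trans (Kt_boundary (S := upset lt (b i)) (i := i) e_sym b_inj Pp Pb Pd _ _) _.
  - exact: up_refl.
  - move=> j ji; apply/negP => bij; have := imax j isT; rewrite /= leqNgt.
    rewrite ltn_rank //; apply: (up_neq_lt bij).
    by rewrite (inj_eq b_inj) eq_sym.
  - apply: subset_leq_card; apply/subsetP => v /bdryP[vS [u uS euv]].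
    exact: up_exit euv.
apply: leq_trans (Kt_boundary (S := [set b i]) (i := i) e_sym b_inj Pp Pb Pd _ _) _.
- exact: set11.
- by move=> j ji; rewrite inE (inj_eq b_inj).
- apply: subset_leq_card; apply/subsetP => v /bdryP[_ [u /set1P-> euv]].
  by rewrite inE.
Qed.

(** * The graphs for the lower bound *)

Section LowerBound.
Variables r N' M : nat.
Let N := N'.+1.

(* An address [s] names the branch of an [N]-ary tree with [r] levels; the node
   at level [i] of that branch is [(i, trunc i s)].  Hanging below each branch
   are [N] disjoint paths with [M] vertices, the [j]-th of which is joined to the
   node at level [j %% r.+1], if there is one. Pairs [(i, s)] with
   [trunc i s != s] are isolated vertices. *)
Definition address := {ffun 'I_r -> 'I_N}.
Definition trunc (i : 'I_r) (s : address) : address :=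
  [ffun a : 'I_r => if a <= i then s a else ord0].

Definition lb_vertex : finType := (('I_r * address) + (address * 'I_N * 'I_M))%type.

Definition lb_attached (x : 'I_r * address) (y : address * 'I_N * 'I_M) : bool :=
  (x.2 == trunc x.1 y.1.1) && (x.1 == y.2 %% r.+1 :> nat).

Definition lb_next (y y' : address * 'I_N * 'I_M) : bool :=
  (y.1 == y'.1) && (y.2.+1 == y'.2 :> nat).

Definition lb_edge : rel lb_vertex := fun u v =>
  match u, v with
  | inl _, inl _ => false
  | inl x, inr y | inr y, inl x => lb_attached x y
  | inr y, inr y' => lb_next y y' || lb_next y' y
  end.

Definition lb_lt : rel lb_vertex := fun u v =>
  match u, v with
  | inl x, inl x' => (x.1 < x'.1) && (x.2 == trunc x.1 x'.2)
  | inl x, inr y => x.2 == trunc x.1 y.1.1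
  | inr _, inl _ => false
  | inr y, inr y' => (y.1 == y'.1) && (y.2 < y'.2)
  end.

Lemma lb_sym : symmetric lb_edge.
Proof. by move=> [x|y] [x'|y'] //=; rewrite orbC. Qed.

Lemma lb_simple : simple_graph lb_edge.
Proof.
split; first exact: lb_sym.
by move=> [x|y] //=; rewrite orbb /lb_next eqn_leq ltnn andbF.
Qed.

Lemma trunc_trunc (i j : 'I_r) s : i <= j -> trunc i (trunc j s) = trunc i s.
Proof.
by move=> ij; apply/ffunP => a; rewrite !ffunE; case: ifP => // ai; rewrite (leq_trans ai ij).
Qed.

Lemma lb_forest : forest_order lb_lt.
Proof.
split.
- by move=> [x|y] /=; rewrite ?ltnn ?andbF.
- move=> [[i s]|[[s k] j]] [[i1 s1]|[[s1 k1] j1]] [[i2 s2]|[[s2 k2] j2]] //=.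
  + move=> /andP[i1i /eqP->] /andP[ii2 /eqP->]; rewrite (ltn_trans i1i ii2) trunc_trunc ?eqxx //.
    exact: ltnW.
  + by move=> /andP[i1i /eqP->] /eqP->; rewrite trunc_trunc ?eqxx // ltnW.
  + by move=> /eqP-> /andP[/eqP[-> _] _].
  + by move=> /andP[/eqP-> jj] /andP[/eqP-> jj']; rewrite eqxx (ltn_trans jj jj').
- move=> [[i s]|[[s k] j]] [[i1 s1]|[[s1 k1] j1]] [[i2 s2]|[[s2 k2] j2]] //=.
  + move=> /andP[ii2 /eqP->] /andP[i1i2 /eqP->].
    case: (ltngtP i i1) => [lt_i|lt_i|/val_inj->]; rewrite ?eqxx //=.
      by rewrite trunc_trunc ?eqxx ?orbT // ltnW.
    by rewrite trunc_trunc ?eqxx ?orbT // ltnW.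
  + move=> /eqP-> /eqP->.
    case: (ltngtP i i1) => [lt_i|lt_i|/val_inj->]; rewrite ?eqxx //=.
      by rewrite trunc_trunc ?eqxx ?orbT // ltnW.
    by rewrite trunc_trunc ?eqxx ?orbT // ltnW.
  + by move=> /eqP-> /andP[/eqP[-> _] _]; rewrite eqxx.
  + by move=> /andP[/eqP[-> _] _] /eqP->; rewrite eqxx.
  + move=> /andP[/eqP-> _] /andP[/eqP-> _]; rewrite eqxx /=.
    by case: (ltngtP j j1) => [||/val_inj->]; rewrite ?orbT // eqxx.
Qed.

Lemma lb_edge_lt u v : lb_edge u v -> lb_lt u v || lb_lt v u.
Proof.
case: u v => [x|[[s k] j]] [x'|[[s' k'] j']] //=.
- by move=> /andP[->].
- by move=> /andP[->].
- by move=> /orP[] /andP[/eqP[-> ->] /eqP /= <-]; rewrite eqxx /= ltnSn ?orbT.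
Qed.

Lemma lb_elim_set_node (x : 'I_r * address) : #|elim_set lb_edge lb_lt (inl x)| <= r.-1.
Proof.
case: x => i s; apply: leq_trans (_ : #|[set (inl (i', trunc i' s) : lb_vertex) | i' in [set~ i]]| <= _).
  apply: subset_leq_card; apply/subsetP => -[[i' s']|y] /elim_setP[] //=.
  by move=> /andP[i'i /eqP->] _; apply/imsetP; exists i'; rewrite // !inE neq_ltn i'i.
by apply: leq_trans (leq_imset_card _ _) _; rewrite cardsC1 card_ord.
Qed.

(** For a path vertex these are the [r] nodes of its branch and its predecessor; earlier path
    vertices have no neighbour in its up-set. *)
Lemma lb_elim_set (v : lb_vertex) : #|elim_set lb_edge lb_lt v| <= r.+1.
Proof.
case: v => [x|[[s k] j]].
  by apply: leq_trans (lb_elim_set_node x) _; lia.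
pose pre := [set (inr (s, k, j') : lb_vertex) | j' in [set j' : 'I_M | (val j').+1 == j]].
apply: leq_trans (_ : #|[set (inl (i, trunc i s) : lb_vertex) | i in 'I_r] :|: pre| <= _); last first.
  apply: leq_trans (leq_card_setU _ _) _; rewrite -addn1; apply: leq_add.
    by apply: leq_trans (leq_imset_card _ _) _; rewrite card_ord.
  apply: leq_trans (leq_imset_card _ _) _; apply/card_le1_eqP => a b.
  by rewrite !inE => /eqP ja /eqP jb; apply: val_inj; apply: succn_inj; rewrite ja jb.
apply: subset_leq_card; apply/subsetP => -[[i s']|[[s' k'] j']] /elim_setP[] /=.
  by move=> /eqP-> _; rewrite inE; apply/orP; left; apply/imsetP; exists i.
move=> /andP[/eqP[-> ->] j'j] [[x|[[s1 k1] jw]]]; rewrite in_up //= => wj ew.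
rewrite inE; apply/orP; right; apply/imsetP; exists j' => //; rewrite inE eqn_leq j'j /=.
have jjw : j <= jw.
  by case/orP: wj => [/eqP[_ _ <-]//|/andP[_ /ltnW]].
by case/orP: ew => /andP[_ /eqP /= E]; move: jjw; rewrite -?E //; lia.
Qed.

Lemma lb_degree (y : address * 'I_N * 'I_M) : #|[set u | lb_edge (inr y) u]| <= 3.
Proof.
case: y => [[s k] j].
pose n1 := [set (inl (i, trunc i s) : lb_vertex) | i in [set i : 'I_r | val i == j %% r.+1]].
pose n2 := [set (inr (s, k, j') : lb_vertex) | j' in [set j' : 'I_M | val j' == j.+1]].
pose n3 := [set (inr (s, k, j') : lb_vertex) | j' in [set j' : 'I_M | (val j').+1 == j]].
have le1 (I : finType) (f : I -> lb_vertex) (g : I -> nat) c : injective g ->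
    #|[set f i | i in [set i | g i == c]]| <= 1.
  move=> g_inj; apply: leq_trans (leq_imset_card _ _) _; apply/card_le1_eqP => a b.
  by rewrite !inE => /eqP ac /eqP bc; apply: g_inj; rewrite ac bc.
have c1 : #|n1| <= 1 by apply: (le1 _ _ val); apply: val_inj.
have c3 : #|n3| <= 1 by apply: (le1 _ _ (fun j' => (val j').+1)) => a b [] /val_inj.
have c2 : #|n2| <= 1 by apply: (le1 _ _ val); apply: val_inj.
apply: (@leq_trans #|n1 :|: n2 :|: n3|); last first.
  apply: leq_trans (leq_card_setU _ _) _; apply: (@leq_add _ _ 2 1) => //.
  by apply: leq_trans (leq_card_setU _ _) _; apply: (@leq_add _ _ 1 1).
apply: subset_leq_card; apply/subsetP => -[[i s']|[[s' k'] j']]; rewrite inE /=.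
  move=> /andP[/= /eqP-> ij]; rewrite !inE; apply/orP; left; apply/orP; left.
  by apply/imsetP; exists i; rewrite ?inE.
case/orP=> /andP[/eqP[E1 E2] /= jj]; rewrite !inE.
  by apply/orP; left; apply/orP; right; apply/imsetP; exists j'; rewrite ?inE ?E1 ?E2 // eq_sym.
by apply/orP; right; apply/imsetP; exists j'; rewrite ?inE ?E1 ?E2.
Qed.

Lemma lb_elim_order : elim_order lb_edge lb_lt r.+1.
Proof. by split; [exact: lb_forest|exact: lb_edge_lt|exact: lb_elim_set]. Qed.

Lemma lb_Kt_free t : (r.+2 < t) || (3 < t.-1) && (r < t) -> Kt_topminor_free t lb_edge.
Proof.
move=> rt; apply: elim_order_Kt_free lb_sym _ lb_elim_order _; first by lia.
move=> v; apply/orP; case/orP: rt => [rt|/andP[t3 rt]].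
  by left; apply: leq_ltn_trans (lb_elim_set v) _; lia.
case: v => [x|y]; last by right; apply: leq_ltn_trans (lb_degree y) _.
left; apply: leq_ltn_trans (lb_elim_set_node x) _; case: x => i s; have := ltn_ord i; lia.
Qed.

(** * These graphs have no narrow partition of small treewidth *)

Section NoPartition.
Variables (U : finType) (eH ltH : rel U) (part : lb_vertex -> U) (c w : nat).
Hypotheses (eH_sym : symmetric eH) (ltH_elim : elim_order eH ltH c).
Hypotheses (partP : is_H_partition lb_edge eH part) (fib : partition_width_le part w).
Hypotheses (c_le_r : c <= r) (N_large : r * (c.+1 * w) < N) (M_def : M = w.+1 * r.+1).

Let x (s : address) (i : 'I_r) : U := part (inl (i, trunc i s)).

Lemma injective_hits (f : 'I_N -> lb_vertex) (S : {set lb_vertex}) :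
  injective f -> #|S| <= r * (c.+1 * w) -> exists a, f a \notin S.
Proof.
move=> f_inj cS; apply/existsP; apply: contraLR N_large; rewrite negb_exists -leqNgt => /forallP fS.
apply: leq_trans cS; rewrite -{1}(card_ord N) -(card_imset _ f_inj).
by apply: subset_leq_card; apply/subsetP => v /imsetP[a _ ->]; apply/negPn/fS.
Qed.

(** The address is chosen level by level: the [N] candidate nodes at the next level cannot all lie
    in the few parts of width [w] already used. *)
Lemma distinct_address : exists s, forall i i', i != i' -> x s i != x s i'.
Proof.
suff H m : m <= r -> exists s, forall i i' : 'I_r, i < i' -> i' < m -> x s i != x s i'.
  have [s sP] := H r (leqnn r); exists s => i i'; rewrite neq_ltn => /orP[ii'|ii'].
    exact: sP.
  by rewrite eq_sym; apply: sP.
elim: m => [|m IH] mr; first by exists [ffun=> ord0].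
have [s sP] := IH (ltnW mr); pose im := Ordinal mr.
pose sa a : address := [ffun y : 'I_r => if y == im then a else s y].
pose S := \bigcup_(i in [set: 'I_r]) [set v | part v == x s i].
have cS : #|S| <= r * (c.+1 * w).
  apply: leq_trans (card_bigcup_leq _ (fun i => fib (x s i))) _.
  by rewrite cardsT card_ord leq_mul2l leq_pmull ?orbT.
have [|a aS] := @injective_hits (fun a => inl (im, trunc im (sa a))) S _ cS.
  move=> a a' [/ffunP/(_ im)]; by rewrite !ffunE leqnn eqxx.
have xs (i : 'I_r) : i < m -> x (sa a) i = x s i.
  move=> im'; rewrite /x; congr (part (inl (_, _))); apply/ffunP => y; rewrite !ffunE.
  by case: ifP => // yi; case: eqP => // E; move: yi; rewrite E /= leqNgt im'.
exists (sa a) => i i' ii'; rewrite ltnS leq_eqVlt => /orP[/eqP E|i'm]; last first.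
  by rewrite !xs ?(ltn_trans ii' i'm) //; apply: sP.
have -> : i' = im by apply: val_inj.
rewrite xs -?E //; apply: contra aS => /eqP xE.
by apply/bigcupP; exists i; rewrite ?inE // xE eqxx.
Qed.

Lemma lb_no_elim_partition : False.
Proof.
have [s s_inj] := distinct_address.
have [ltH_forest eH_lt Ac] := ltH_elim.
have cbag h : #|elim_bag eH ltH h| <= c.+1.
  by rewrite cardsU1; have := Ac h; case: (h \notin _) => /=; lia.
pose S := \bigcup_(i in [set: 'I_r])
  \bigcup_(h in elim_bag eH ltH (x s i)) [set v | part v == h].
have cS : #|S| <= r * (c.+1 * w).
  apply: (@leq_trans (#|[set: 'I_r]| * (c.+1 * w))); last by rewrite cardsT card_ord.
  apply: card_bigcup_leq => i; apply: leq_trans (card_bigcup_leq _ fib) _.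
  by rewrite leq_mul2r cbag orbT.
(* The paths are disjoint and outnumber the vertices in [S], so one of them avoids all bags of the
   parts of the nodes. *)
have [k kS] : exists k, forall j, inr (s, k, j) \notin S.
  have [/forallP allk|] := boolP [forall k, [exists j, inr (s, k, j) \in S]]; last first.
    by rewrite negb_forall => /existsP[k]; rewrite negb_exists => /forallP kS; exists k.
  have [f fP] : exists f : 'I_N -> 'I_M, forall k, inr (s, k, f k) \in S.
    by apply: (fin_all_exists (P := fun k j => inr (s, k, j) \in S)) => k; apply/existsP.
  have [|a] := @injective_hits (fun k => inr (s, k, f k)) S _ cS; first by move=> a a' [].
  by rewrite fP.
pose q (j : 'I_M) : U := part (inr (s, k, j)).
have qbag i j : q j \notin elim_bag eH ltH (x s i).
  apply: contra (kS j) => qb; apply/bigcupP; exists i; rewrite ?inE //.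
  by apply/bigcupP; exists (q j) => //; rewrite inE.
have qx i j : q j != x s i by apply: contraNneq (qbag i j) => ->; rewrite setU11.
pose Iv lo hi := [set q j | j in [set j : 'I_M | lo <= j < hi]].
have IvP lo hi (j : 'I_M) : lo <= j < hi -> q j \in Iv lo hi.
  by move=> jI; apply: imset_f; rewrite inE.
have cIv lo hi : conn eH (Iv lo hi).
  have symR := sym_connect_sym (restr_sym eH_sym (Iv lo hi)).
  have step d (j1 j2 : 'I_M) : lo <= j1 -> j2 < hi -> j2 = j1 + d :> nat ->
      connect (restr eH (Iv lo hi)) (q j1) (q j2).
    elim: d j2 => [|d IH] j2 lo1 hi2 E.
      by rewrite (_ : j2 = j1) //; apply: val_inj; rewrite /= E addn0.
    have lt' : (j1 + d) < M by have := ltn_ord j2; lia.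
    apply: (@connect_trans _ _ (q (Ordinal lt'))); first by apply: IH => //=; lia.
    have ed : lb_edge (inr (s, k, Ordinal lt')) (inr (s, k, j2)).
      by rewrite /= /lb_next eqxx /= E addnS eqxx.
    case: (partP ed) => [eq_q|eq_q]; first by rewrite /q eq_q.
    by apply: connect1; rewrite /restr /= !IvP //=; lia.
  apply/connP => a b /imsetP[j1]; rewrite inE => /andP[lo1 hi1] ->.
  move=> /imsetP[j2]; rewrite inE => /andP[lo2 hi2] ->.
  have [j12|j21] := leqP j1 j2; first by apply: (step (j2 - j1)) => //; lia.
  by rewrite symR; apply: (step (j1 - j2)) => //; lia.
have att (i : 'I_r) (j : 'I_M) : j %% r.+1 = i -> eH (x s i) (q j).
  move=> ji; have ed : lb_edge (inl (i, trunc i s)) (inr (s, k, j)).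
    by rewrite /= /lb_attached /= eqxx ji eqxx.
  by case: (partP ed) => // E; have := qx i j; rewrite /q /x -E eqxx.
pose C := Iv 0 M.
have qC j : q j \in C by apply: IvP; rewrite ltn_ord.
have Cq h : h \in C -> exists j, h = q j by case/imsetP => j _ ->; exists j.
have nCA i h : h \in C -> h \notin elim_set eH ltH (x s i).
  by case/Cq => j ->; apply: contra (qbag i j) => hA; rewrite in_setU1 hA orbT.
(* The parts [C] of the path form a connected set that avoids [elim_set] of [x s i] and contains a
   neighbour of [x s i], so all of [C] lies above it. *)
have x_lt i j : ltH (x s i) (q j).
  have iM : i < M by rewrite M_def; have := ltn_ord i; nia.
  have ed := att i (Ordinal iM) (modn_small (ltnW (ltn_ord i) : i < r.+1)).
  have x0 : ltH (x s i) (q (Ordinal iM)).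
    case/orP: (eH_lt _ _ ed) => // qlt.
    have /negP[] := nCA i _ (qC (Ordinal iM)); apply/elim_setP; split=> //.
    by exists (x s i); rewrite ?up_refl // eH_sym.
  apply: up_neq_lt; last by rewrite eq_sym qx.
  apply/negPn/negP => nup.
  have [h hC /(negP (nCA i h hC))//] :=
    conn_up_exit eH_sym ltH_forest eH_lt (cIv 0 M) (qC _) (qC j) (lt_up x0) nup.
(* A segment of [r.+1] consecutive vertices sees every node, so the elimination set of its root
   contains all [r] parts [x s i]. As [c <= r], it contains nothing else. *)
have segP (a : 'I_w.+1) : exists j : 'I_M, (a * r.+1 <= j < a.+1 * r.+1) /\
    elim_set eH ltH (q j) = [set x s i | i in 'I_r].
  have aM d : d < r.+1 -> a * r.+1 + d < M by have := ltn_ord a; rewrite M_def; nia.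
  have Dn : Iv (a * r.+1) (a.+1 * r.+1) != set0.
    by apply/set0Pn; exists (q (Ordinal (aM 0 isT))); apply: IvP; rewrite /= mulSn; lia.
  have [y yI yU] := conn_min eH_sym ltH_forest eH_lt (cIv _ _) Dn.
  case/imsetP: yI => j; rewrite inE => jI yE; exists j; split=> //.
  apply/eqP; rewrite eq_sym eqEcard; apply/andP; split; last first.
    rewrite card_imset; last by move=> i i' E; apply/eqP/negPn/negP => /s_inj; rewrite E eqxx.
    by rewrite card_ord; apply: leq_trans c_le_r.
  apply/subsetP => h /imsetP[i _ ->]; apply/elim_setP; split; first exact: x_lt.
  have ir := ltnW (ltn_ord i) : i < r.+1; exists (q (Ordinal (aM i ir))).
    by rewrite -yE; apply: (subsetP yU); apply: IvP; rewrite /= mulSn; lia.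
  by apply: att; rewrite /= modnMDl modn_small.
have [f fP] := fin_all_exists segP.
(* [C] avoids these elimination sets, so it lies above the root of each segment. The roots are thus
   above each other and coincide, giving [w.+1] vertices in one part. *)
have upq a b : q (f a) \in upset ltH (q (f b)).
  apply/negPn/negP => nup.
  have [h /Cq[j ->]] := conn_up_exit eH_sym ltH_forest eH_lt (cIv 0 M) (qC (f b)) (qC (f a)) (up_refl _ _) nup.
  by have [_ ->] := fP b; case/imsetP => i _ E; have := qx i j; rewrite E eqxx.
have qE a : q (f a) = q (f ord0) by apply: (up_anti ltH_forest).
have f_inj : injective f.
  move=> a b E; have [/andP[a1 a2] _] := fP a; have [/andP[b1 b2] _] := fP b.
  apply: val_inj => /=; move: a1 a2 b1 b2; rewrite E; set j := nat_of_ord (f b); clear; nia.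
have := fib (q (f ord0)); rewrite leqNgt => /negP[].
have <- : #|[set (inr (s, k, f a) : lb_vertex) | a in 'I_w.+1]| = w.+1.
  by rewrite card_imset ?card_ord // => a b [] /f_inj.
by apply: subset_leq_card; apply/subsetP => v /imsetP[a _ ->]; rewrite inE -(qE a).
Qed.
End NoPartition.
End LowerBound.

(** * From single graphs to graph classes *)

Lemma lb_not_tpw_le r c w : c <= r ->
  ~ tpw_le c (@lb_edge r (r * (c.+1 * w)) (w.+1 * r.+1)) w.
Proof.
move=> cr [U [eH [part [eH_simple tw partP fib]]]].
have [ltH eo] := tw_le_elim_order eH_simple tw; have [eH_sym _] := eH_simple.
exact: (lb_no_elim_partition eH_sym eo partP fib cr (leqnn _) erefl).
Qed.

(** Having treewidth at most [k] is not given as a decidable property, so the least such [k] is only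
    produced when the goal is a contradiction. *)
Lemma is_tw_below (T : finType) (e : rel T) K :
  tw_le e K -> (forall k, k <= K -> is_tw e k -> False) -> False.
Proof.
elim/ltn_ind: K => K IH tw no_tw; apply: (no_tw K (leqnn K)); split=> // k' tw'.
rewrite leqNgt; apply/negP => k'K; apply: (IH k' k'K tw') => k kk'.
by apply: no_tw; apply: leq_trans kk' (ltnW k'K).
Qed.

Lemma tpw_le_mono c (T : finType) (e : rel T) w w' :
  w <= w' -> tpw_le c e w -> tpw_le c e w'.
Proof.
move=> ww' [U [eH [part [simpleH twH partH fib]]]]; exists U, eH, part; split=> // h.
exact: leq_trans (fib h) ww'.
Qed.

Lemma underlying_tw_gt (C : graph_class) r c :
  (forall N' M, C _ (@lb_edge r N' M)) -> tpw_bounded_by_tw C c -> r < c.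
Proof.
move=> CG [f fP]; rewrite ltnNge; apply/negP => cr.
(* Only the upper bound [r.+1] on the treewidth of the graph is known, so [w] covers every possible
   value up to it. *)
pose w := \max_(k < r.+2) f k.
apply: (@is_tw_below _ (@lb_edge r (r * (c.+1 * w)) (w.+1 * r.+1)) r.+1).
  exact: elim_order_tw_le (@lb_sym _ _ _) (@lb_elim_order _ _ _).
move=> k kr tw_k; apply: (@lb_not_tpw_le r c w cr).
apply: tpw_le_mono (fP _ _ (@lb_simple _ _ _) (CG _ _) k tw_k).
by rewrite -ltnS in kr; apply: (leq_bigmax (Ordinal kr)).
Qed.

Lemma underlying_tw_le (C : graph_class) c n :
  (forall (T : finType) (e : rel T), simple_graph e -> C T e -> disjointed e c n) ->
  tpw_bounded_by_tw C c.
Proof.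
move=> Cd; exists (fun k => 2 * (n.+1 * (2 * k.+1) ^ c).+1 * k.+1) => T e simple_e Ce k [tw_k _].
exact: disjointed_tpw_le simple_e tw_k (Cd T e simple_e Ce).
Qed.

Theorem theorem6p2 (t : nat) (ht : 2 <= t) :
  underlying_tw (Kt_topminor_free t) (if t <= 4 then t - 2 else t).
Proof.
split.
  case: leqP => t4.
    have : [|| t == 2, t == 3 | t == 4] by lia.
    case/or3P=> /eqP->.
    - by apply: (@underlying_tw_le _ _ 2) => T e [e_sym _]; apply: K2_free_disjointed.
    - by apply: (@underlying_tw_le _ _ 2) => T e [e_sym _]; apply: K3_free_disjointed.
    - by apply: (@underlying_tw_le _ _ 3) => T e [e_sym _]; apply: K4_free_disjointed.
  by apply: (@underlying_tw_le _ _ (t * t)) => T e [e_sym _]; apply: Kt_free_disjointed.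
move=> c' bounded; have [->//|t2] := eqVneq t 2.
(* These are the largest [r] that [lb_Kt_free] allows, and [r < c'] is then the claimed bound; for
   [t = 2] the bound is [0]. *)
pose r := if t <= 4 then t - 3 else t.-1.
have : r < c'.
  apply: underlying_tw_gt bounded => N' M; apply: lb_Kt_free.
  by rewrite /r; case: ifP; lia.
by rewrite /r; case: ifP; lia.
Qed.
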